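(* Let $0<\alpha\le 1$. For every $f\in\mathcal{G}(\alpha)$, the logarithmic coefficients $\gamma_n$ of $f$ satisfy the inequalities $$\sum_{n=1}^{\infty}n^{2}|\gamma_{n}|^{2}\leq\frac{\alpha}{4(\alpha+2)}$$ and $$\sum_{n=1}^{\infty}|\gamma_{n}|^{2}\leq \frac{\alpha^2}{4}\,\mathrm{Li}_{2}\left(\frac{1}{(1+\alpha)^2}\right).$$ Also, $$|\gamma_{n}|\leq \frac{\alpha}{2(\alpha+1)n}\quad\text{for all } n\ge 1.$$
   Context: Let $\mathbb{D}=\{z\in\mathbb{C}:|z|<1\}$. For $0<\alpha\le 1$, $\mathcal{G}(\alpha)$ denotes the class of functions $f$ analytic and locally univalent in $\mathbb{D}$ with $f(0)=0$, $f'(0)=1$, satisfying $$\mathrm{Re}\left(1+\frac{zf''(z)}{f'(z)}\right)<1+\frac{\alpha}{2}\quad\text{for all } z\in\mathbb{D}.$$ Such functions are known to be starlike, hence univalent, so $f(z)/z$ (with value $1$ at $0$) is non-vanishing in $\mathbb{D}$. The logarithmic coefficients $\gamma_n$ of $f$ are defined by $\frac12\log\frac{f(z)}{z}=\sum_{n=1}^\infty\gamma_n z^n$, $z\in\mathbb{D}$, where the branch of the logarithm vanishes at $z=0$. The dilogarithm is $\mathrm{Li}_2(z)=\sum_{n=1}^\infty \frac{z^n}{n^2}$ for $|z|\le 1$. *)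

(* Defs.v *)
From Stdlib Require Import Reals.
From Coquelicot Require Import Coquelicot.
Open Scope R_scope.

(* Functions on the unit disk are total functions [C -> C]; their values
   outside the disk are irrelevant in everything below. *)
Definition in_disk (z : C) : Prop := Cmod z < 1.

Definition analytic_in_disk (f : C -> C) : Prop :=
  forall z : C, in_disk z -> @ex_derive C_AbsRing C_NormedModule f z.

Definition locally_univalent_in_disk (f : C -> C) : Prop :=
  forall z : C, in_disk z ->
    exists r : R, 0 < r /\
      forall u v : C, in_disk u -> in_disk v ->
        Cmod (u - z) < r -> Cmod (v - z) < r -> f u = f v -> u = v.

(* [C_derive] is a total operator, computed by a limit along the real direction;
   it is the complex derivative wherever the latter exists. *)
Definition class_G (alpha : R) (f : C -> C) : Prop :=
  analytic_in_disk f /\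
  locally_univalent_in_disk f /\
  f (RtoC 0) = RtoC 0 /\
  C_derive f (RtoC 0) = RtoC 1 /\
  (forall z : C, in_disk z ->
     Re (1 + z * C_derive (C_derive f) z / C_derive f z)%C < 1 + alpha / 2).

Definition Cexp (z : C) : C :=
  (exp (Re z) * cos (Im z), exp (Re z) * sin (Im z)).

(* [L] is the branch on the disk of log (f z / z) that vanishes at 0.  At z = 0,
   where f z / z is given the value 1, the equation Cexp (L z) = f z / z
   amounts to Cexp 0 = 1. *)
Definition log_branch (f L : C -> C) : Prop :=
  (forall z : C, in_disk z -> @continuous C_UniformSpace C_UniformSpace L z) /\
  L (RtoC 0) = RtoC 0 /\
  (forall z : C, in_disk z -> z <> RtoC 0 -> Cexp (L z) = (f z / z)%C).

(* Only the terms gamma n with n >= 1 are meaningful; gamma 0 is unconstrained. *)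
Definition logarithmic_coefficients (f : C -> C) (gamma : nat -> C) : Prop :=
  exists L : C -> C, log_branch f L /\
    forall z : C, in_disk z ->
      @is_series C_AbsRing C_NormedModule
        (fun n : nat => (gamma (S n) * z ^ S n)%C) (/ 2 * L z)%C.

(* The dilogarithm at real arguments x with |x| <= 1. *)
Definition Li2 (x : R) : R := Series (fun n : nat => x ^ S n / INR (S n) ^ 2).

(* Main.v *)
Require Import Defs.
From Stdlib Require Import Reals Lra Lia Psatz Classical ClassicalEpsilon List.
From Coquelicot Require Import Coquelicot.
Import ListNotations.
Open Scope R_scope.

(* The power series L of the logarithm gives f = z exp L, so with p = z L' = sum_n 2 n gamma_n z^n one has
   z f''/f' = p + z p' / (1 + p).  Jack's argument shows that p is subordinate to
   - alpha z / (1 + alpha - z): at a first point z0 where p reaches the boundary of the image disk,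
   let g be p rescaled to the unit disk.  Differentiating the Schwarz-Pick inequality at z0 gives
   z0 g'(z0) = k g(z0) with k real and bounded below, which contradicts the hypothesis on f; if
   1 + p(z0) = 0, this zero is simple and Re (z f''/f') is unbounded above near z0.
   Multiplication by g is then a contraction of H^2, and testing it on 1 + t z^n with the optimal t gives
   alpha (2 + alpha) sum_(k < n) |p_k|^2 + (1 + alpha)^2 |p_n|^2 <= alpha^2,
   from which the three bounds follow (the second one by Abel summation). *)

(** * Complex power series on the unit disk *)

(** The disk onto which p is rescaled has -1 on its boundary, so 1 + p is a positive multiple of 1 +
    g, without a constant term. Hence Re (z p' / (1 + p)) = k / 2 at every touching point with g <>
    -1, and g = -1 is exactly the case of a zero of 1 + p. Since p(0) = 0, the rescaled function
    starts at g(0) = 1 / (1 + alpha), not at 0. No constant lower bound on k would do: Re p ranges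
    from -1 to alpha / (2 + alpha) on the boundary circle. With a = g(0), Schwarz-Pick gives k >= |1
    - a g|^2 / (1 - a^2), which is large where Re p is small. The extremal p = - alpha z / (1 +
    alpha - z) has |p_n|^2 = alpha^2 / (1 + alpha)^(2 n). The coefficient inequality bounds every
    partial sum of |p_k|^2 by that of this function, and such a bound survives decreasing weights
    although it need not hold term by term. No contour integral occurs: means over sufficiently many
    roots of unity are exact on polynomials, and analytic functions enter through uniform polynomial
    approximation on closed disks. *)

Lemma Cmod_le_of_sqr (z : C) (x : R) : 0 <= x -> Cmod z ^ 2 <= x ^ 2 -> Cmod z <= x.
Proof.
  intros Hx H. apply Rnot_lt_le; intro Hlt. pose proof (Cmod_ge_0 z). nra.
Qed.

Lemma Cmod_minus_sym (z w : C) : Cmod (z - w) = Cmod (w - z).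
Proof. rewrite <- Cmod_opp. f_equal. ring. Qed.

Lemma Cmod_triangle_minus (z w : C) : Cmod (z - w) <= Cmod z + Cmod w.
Proof.
  unfold Cminus. eapply Rle_trans; [apply Cmod_triangle|]. rewrite Cmod_opp; lra.
Qed.

Lemma Cmod_triangle_rev (z w : C) : Cmod z <= Cmod w + Cmod (z - w).
Proof.
  replace z with (w + (z - w))%C at 1 by ring. apply Cmod_triangle.
Qed.

Lemma Cminus_plus (z w : C) : (z - w + w)%C = z.
Proof. ring. Qed.

Lemma Cmod_INR (n : nat) : Cmod (RtoC (INR n)) = INR n.
Proof. rewrite Cmod_R, Rabs_pos_eq; [reflexivity | apply pos_INR]. Qed.

Lemma is_derive_C_intro (f : C -> C) (z l : C) :
  (forall eps, 0 < eps -> exists d, 0 < d /\ forall h, Cmod h < d ->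
     Cmod (f (z + h) - f z - l * h)%C <= eps * Cmod h) ->
  @is_derive C_AbsRing C_NormedModule f z l.
Proof.
  intros H. split; [apply is_linear_scal_l|].
  intros x Hx eps.
  apply @is_filter_lim_locally_unique in Hx. subst x.
  destruct (H eps (cond_pos eps)) as [d [Hd Hf]].
  exists (mkposreal d Hd). intros y Hy. change (Cmod (y - z)%C < d) in Hy.
  specialize (Hf (y - z)%C Hy).
  replace (z + (y - z))%C with (y : C) in Hf by (clear; change C in y; ring).
  rewrite (Cmult_comm l) in Hf. exact Hf.
Qed.

Lemma is_derive_C_elim (f : C -> C) (z l : C) :
  @is_derive C_AbsRing C_NormedModule f z l ->
  forall eps, 0 < eps -> exists d, 0 < d /\ forall h, Cmod h < d ->
     Cmod (f (z + h) - f z - l * h)%C <= eps * Cmod h.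
Proof.
  intros [_ H] eps Heps.
  specialize (H z (fun P HP => HP) (mkposreal eps Heps)).
  destruct H as [d Hd].
  exists d. split; [apply cond_pos|]. intros h Hh.
  assert (E : (z + h - z)%C = h) by ring.
  specialize (Hd (z + h)%C).
  assert (Hb : @ball (AbsRing_UniformSpace C_AbsRing) z d (z + h)%C).
  { change (Cmod (z + h - z)%C < d). rewrite E. exact Hh. }
  specialize (Hd Hb).
  change (Cmod (f (z + h) - f z - (z + h - z) * l)%C <= eps * Cmod (z + h - z)%C) in Hd.
  rewrite E, (Cmult_comm h) in Hd. exact Hd.
Qed.

Lemma is_series_C_iff (a : nat -> C) (l : C) :
  @is_series C_AbsRing C_NormedModule a l <->
  forall eps, 0 < eps -> exists N, forall n, (N <= n)%nat -> Cmod (sum_n a n - l)%C < eps.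
Proof.
  unfold is_series. split.
  - intros H eps Heps.
    apply (proj1 (filterlim_locally_ball_norm (K := C_AbsRing) (U := C_NormedModule) _ _) H (mkposreal eps Heps)).
  - intros H. apply (proj2 (filterlim_locally_ball_norm (K := C_AbsRing) (U := C_NormedModule) _ _)).
    intros eps. destruct (H eps (cond_pos eps)) as [N HN]. exists N. exact HN.
Qed.

Lemma is_series_C_unique (a : nat -> C) (l l' : C) :
  @is_series C_AbsRing C_NormedModule a l ->
  @is_series C_AbsRing C_NormedModule a l' -> l = l'.
Proof.
  intros H H'. exact (filterlim_locally_unique (K:=C_AbsRing) (V:=C_NormedModule) _ _ _ H H').
Qed.

Lemma is_series_C_ext (a b : nat -> C) (l l' : C) :
  (forall n, a n = b n) -> l = l' ->
  @is_series C_AbsRing C_NormedModule a l -> @is_series C_AbsRing C_NormedModule b l'.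
Proof. intros Hab Hl H. rewrite <- Hl. now apply is_series_ext with a. Qed.

Lemma is_series_C_minus (a b : nat -> C) (l l' : C) :
  @is_series C_AbsRing C_NormedModule a l -> @is_series C_AbsRing C_NormedModule b l' ->
  @is_series C_AbsRing C_NormedModule (fun n => a n - b n)%C (l - l')%C.
Proof. exact (is_series_minus a b l l'). Qed.

Lemma is_series_C_plus (a b : nat -> C) (l l' : C) :
  @is_series C_AbsRing C_NormedModule a l -> @is_series C_AbsRing C_NormedModule b l' ->
  @is_series C_AbsRing C_NormedModule (fun n => a n + b n)%C (l + l')%C.
Proof. exact (is_series_plus a b l l'). Qed.

Lemma is_series_C_scal (k : C) (a : nat -> C) (l : C) :
  @is_series C_AbsRing C_NormedModule a l ->
  @is_series C_AbsRing C_NormedModule (fun n => k * a n)%C (k * l)%C.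
Proof. exact (is_series_scal k a l). Qed.

Lemma is_series_C_tail (a : nat -> C) (l : C) :
  @is_series C_AbsRing C_NormedModule a l ->
  @is_series C_AbsRing C_NormedModule (fun n => a (S n)) (l - a 0%nat)%C.
Proof.
  intros H. apply (is_series_incr_1 (K:=C_AbsRing) (V:=C_NormedModule) a).
  refine (eq_ind_r (fun l => @is_series C_AbsRing C_NormedModule a l) H _).
  exact (Cminus_plus l (a 0%nat)).
Qed.

Lemma is_series_C_cons (a : nat -> C) (l : C) :
  @is_series C_AbsRing C_NormedModule (fun n => a (S n)) l ->
  @is_series C_AbsRing C_NormedModule a (a 0%nat + l)%C.
Proof.
  intros H. apply (is_series_decr_1 (K:=C_AbsRing) (V:=C_NormedModule) a).
  refine (eq_ind_r (fun l => @is_series C_AbsRing C_NormedModule _ l) H _).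
  change (a 0%nat + l + - a 0%nat = l)%C. ring.
Qed.

(* The sum is only meaningful for convergent series. *)
Definition CSeries (a : nat -> C) : C :=
  epsilon (inhabits (RtoC 0)) (fun l => @is_series C_AbsRing C_NormedModule a l).

Lemma CSeries_unique (a : nat -> C) (l : C) :
  @is_series C_AbsRing C_NormedModule a l -> CSeries a = l.
Proof.
  intros H. apply is_series_C_unique with a; [|exact H].
  apply (epsilon_spec (inhabits (RtoC 0)) (fun l => is_series a l)). now exists l.
Qed.

Lemma CSeries_correct (a : nat -> C) (b : nat -> R) :
  (forall n, Cmod (a n) <= b n) -> ex_series b ->
  @is_series C_AbsRing C_NormedModule a (CSeries a).
Proof.
  intros Hab Hb.
  assert (He : @ex_series C_AbsRing C_CompleteNormedModule a)
    by (apply ex_series_le with b; [exact Hab | exact Hb]).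
  destruct He as [l Hl].
  replace (CSeries a) with l; [exact Hl|]. symmetry; now apply CSeries_unique.
Qed.

Lemma is_series_C_norm_le (a : nat -> C) (b : nat -> R) (l : C) :
  (forall n, Cmod (a n) <= b n) -> ex_series b ->
  @is_series C_AbsRing C_NormedModule a l -> Cmod l <= Series b.
Proof.
  intros Hab Hb Ha.
  assert (Hs : forall n, Cmod (sum_n a n) <= Series b).
  { intros n. apply Rle_trans with (sum_n b n).
    - induction n; [rewrite !sum_O; apply Hab|].
      rewrite !sum_Sn. eapply Rle_trans; [apply Cmod_triangle|].
      apply Rplus_le_compat; auto.
    - assert (H0 : forall k, 0 <= b k)
        by (intros k; eapply Rle_trans; [apply Cmod_ge_0 | apply Hab]).
      destruct Hb as [s Hs]. rewrite (is_series_unique _ _ Hs).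
      apply (is_lim_seq_incr_compare (sum_n b)); [exact Hs|].
      intros k. rewrite sum_Sn. change plus with Rplus. specialize (H0 (S k)). lra. }
  apply Rnot_lt_le; intro Hlt.
  destruct (proj1 (is_series_C_iff a l) Ha (Cmod l - Series b)) as [N HN]; [lra|].
  specialize (HN N (le_n _)). specialize (Hs N).
  pose proof (Cmod_triangle_rev l (sum_n a N)).
  rewrite Cmod_minus_sym in HN. lra.
Qed.

(* Equivalent to a radius of convergence of at least 1. *)
Definition disk_coef (c : nat -> C) : Prop :=
  forall r, 0 <= r < 1 -> exists M, forall n, Cmod (c n) * r ^ n <= M.

Definition PS (c : nat -> C) (z : C) : C := CSeries (fun n => c n * z ^ n)%C.

Definition dcoef (c : nat -> C) (n : nat) : C := (RtoC (INR (S n)) * c (S n))%C.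

(** Each of the n terms of 1 + x + ... + x^(n-1) is at least x^n, and this sum is at most 1 / (1 -
    x). *)
Lemma n_pow_bound (x : R) (n : nat) : 0 <= x < 1 -> INR n * x ^ n <= / (1 - x).
Proof.
  intros Hx.
  assert (Hp : forall k, 0 <= x ^ k) by (intros; apply pow_le; lra).
  assert (H : INR n * (1 - x) * x ^ n <= 1 - x ^ n).
  { induction n; [simpl; lra|].
    rewrite S_INR. simpl. specialize (Hp n).
    assert (Hm : INR n * (1 - x) * (x * x ^ n) <= x * (1 - x ^ n))
      by (replace (INR n * (1 - x) * (x * x ^ n)) with (x * (INR n * (1 - x) * x ^ n)) by ring;
          apply Rmult_le_compat_l; lra).
    assert (x * x ^ n * (1 - x) <= 1 * (1 - x)).
    { apply Rmult_le_compat_r; [lra|].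
      assert (x ^ n <= 1) by (rewrite <- (pow1 n); apply pow_incr; lra). nra. }
    lra. }
  apply Rmult_le_reg_r with (1 - x); [lra|].
  rewrite Rinv_l by lra. specialize (Hp n). lra.
Qed.

Lemma disk_coef_mult_n (c : nat -> C) :
  disk_coef c -> disk_coef (fun n => RtoC (INR n) * c n)%C.
Proof.
  intros Hc r Hr.
  destruct (Hc ((1 + r) / 2)) as [M HM]; [lra|].
  (* A radius strictly between r and 1: the coefficients are bounded against s^n, and the geometric
     factor (r / s)^n that is left over absorbs the n. *)
  set (s := (1 + r) / 2) in *.
  assert (Hq : 0 <= r / s < 1).
  { unfold s. split; [apply Rdiv_le_0_compat; lra|].
    apply Rmult_lt_reg_r with ((1 + r) / 2); [lra|]. field_simplify; lra. }
  assert (HM0 : 0 <= M) by (specialize (HM 0%nat); simpl in HM; pose proof (Cmod_ge_0 (c 0%nat)); lra).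
  exists (M * / (1 - r / s)). intros n.
  rewrite Cmod_mult, Cmod_INR.
  replace r with (s * (r / s)) at 1 by (field; unfold s; lra).
  rewrite Rpow_mult_distr.
  replace (INR n * Cmod (c n) * (s ^ n * (r / s) ^ n))
    with ((Cmod (c n) * s ^ n) * (INR n * (r / s) ^ n)) by ring.
  apply Rmult_le_compat; [|apply Rmult_le_pos; [apply pos_INR|apply pow_le; lra]|apply HM|now apply n_pow_bound].
  apply Rmult_le_pos; [apply Cmod_ge_0|apply pow_le; unfold s; lra].
Qed.

Lemma disk_coef_shift (c : nat -> C) : disk_coef c -> disk_coef (fun n => c (S n)).
Proof.
  intros Hc r Hr.
  destruct (Hc ((1 + r) / 2)) as [M HM]; [lra|].
  set (s := (1 + r) / 2) in *.
  exists (M / s). intros n. specialize (HM (S n)).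
  apply Rmult_le_reg_r with s; [unfold s; lra|].
  unfold Rdiv. rewrite Rmult_assoc, Rmult_assoc, Rinv_l, Rmult_1_r by (unfold s; lra).
  eapply Rle_trans; [|exact HM].
  apply Rmult_le_compat_l; [apply Cmod_ge_0|].
  simpl. rewrite Rmult_comm. apply Rmult_le_compat_l; [unfold s; lra|].
  apply pow_incr. unfold s; lra.
Qed.

Lemma disk_coef_dcoef (c : nat -> C) : disk_coef c -> disk_coef (dcoef c).
Proof. intros Hc. exact (disk_coef_shift _ (disk_coef_mult_n c Hc)). Qed.

Lemma disk_coef_abs_series (c : nat -> C) (r : R) :
  disk_coef c -> 0 <= r < 1 -> ex_series (fun n => Cmod (c n) * r ^ n).
Proof.
  intros Hc Hr.
  destruct (Hc ((1 + r) / 2)) as [M HM]; [lra|].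
  set (s := (1 + r) / 2) in *.
  assert (Hs : 0 < s) by (unfold s; lra).
  assert (Hq : 0 <= r / s < 1).
  { split; [apply Rdiv_le_0_compat; lra|].
    apply Rmult_lt_reg_r with s; [lra|]. unfold s; field_simplify; lra. }
  apply (@ex_series_le R_AbsRing R_CompleteNormedModule) with (fun n => M * (r / s) ^ n).
  - intros n. change norm with Rabs.
    rewrite Rabs_pos_eq by (apply Rmult_le_pos; [apply Cmod_ge_0|apply pow_le; lra]).
    replace r with (s * (r / s)) at 1 by (field; lra).
    rewrite Rpow_mult_distr, <- Rmult_assoc.
    apply Rmult_le_compat_r; [apply pow_le; lra|apply HM].
  - apply (ex_series_scal_l M (fun n => (r/s)^n)). exists (/ (1 - r / s)). apply is_series_geom.
    rewrite Rabs_pos_eq; lra.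
Qed.

Lemma PS_term_le (c : nat -> C) (z : C) (r : R) (n : nat) :
  Cmod z <= r -> Cmod (c n * z ^ n)%C <= Cmod (c n) * r ^ n.
Proof.
  intros Hz. rewrite Cmod_mult, Cmod_pow.
  apply Rmult_le_compat_l; [apply Cmod_ge_0|].
  apply pow_incr; split; [apply Cmod_ge_0|exact Hz].
Qed.

Lemma PS_correct (c : nat -> C) (z : C) :
  disk_coef c -> Cmod z < 1 ->
  @is_series C_AbsRing C_NormedModule (fun n => c n * z ^ n)%C (PS c z).
Proof.
  intros Hc Hz. apply CSeries_correct with (fun n => Cmod (c n) * Cmod z ^ n).
  - intros n. apply PS_term_le. lra.
  - apply disk_coef_abs_series; [exact Hc|]. split; [apply Cmod_ge_0|exact Hz].
Qed.

(** The tail at any z of the closed disk is dominated by the tail of the one real series of |c_n|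
    r^n, so N does not depend on z. *)
Lemma PS_unif (c : nat -> C) (r eps : R) :
  disk_coef c -> 0 <= r < 1 -> 0 < eps ->
  exists N, forall n, (N <= n)%nat -> forall z, Cmod z <= r ->
    Cmod (PS c z - sum_n (fun n => c n * z ^ n)%C n)%C <= eps.
Proof.
  intros Hc Hr Heps.
  set (b := fun n => Cmod (c n) * r ^ n).
  assert (Hb : ex_series b) by now apply disk_coef_abs_series.
  assert (Hlim : is_lim_seq (sum_n b) (Series b)) by exact (Series_correct _ Hb).
  apply is_lim_seq_spec in Hlim. destruct (Hlim (mkposreal eps Heps)) as [N HN].
  simpl in HN. exists N. intros n Hn z Hz.
  assert (Hs := PS_correct c z Hc (Rle_lt_trans _ _ _ Hz (proj2 Hr))).
  set (a := fun n => (c n * z ^ n)%C) in *.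
  assert (Ht : @is_series C_AbsRing C_NormedModule (fun k => a (S n + k)%nat) (PS c z - sum_n a n)%C).
  { apply (is_series_incr_n (K:=C_AbsRing) (V:=C_NormedModule) a (S n)); [lia|].
    refine (eq_ind_r (fun l => @is_series C_AbsRing C_NormedModule a l) Hs _).
    exact (Cminus_plus (PS c z) (sum_n a n)). }
  eapply Rle_trans.
  - apply is_series_C_norm_le with (3 := Ht) (b := fun k => b (S n + k)%nat).
    + intros k. now apply PS_term_le.
    + now apply (ex_series_incr_n (K:=R_AbsRing) (V:=R_NormedModule) b (S n)).
  - specialize (HN n Hn).
    rewrite (Series_incr_n b (S n)) in HN by (lia || exact Hb).
    simpl Nat.pred in HN. rewrite <- sum_n_Reals in HN.
    apply Rabs_lt_between in HN. simpl plus in HN |- *. lra.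
Qed.

(* The remainder of the binomial expansion, multiplied by s to avoid a power s^(m-1). *)
Lemma pow_second_order (z h : C) (s : R) (m : nat) :
  Cmod z <= s -> Cmod (z + h) <= s ->
  s * Cmod ((z + h) ^ S m - z ^ S m - RtoC (INR (S m)) * z ^ m * h)%C
    <= INR (S m) ^ 2 * s ^ m * Cmod h ^ 2.
Proof.
  intros Hz Hzh.
  assert (Hs : 0 <= s) by (eapply Rle_trans; [apply Cmod_ge_0|exact Hz]).
  induction m.
  - replace ((z + h) ^ 1 - z ^ 1 - RtoC (INR 1) * z ^ 0 * h)%C with (RtoC 0) by (simpl; ring).
    rewrite Cmod_0. simpl. pose proof (Cmod_ge_0 h). nra.
  - set (E := ((z + h) ^ S m - z ^ S m - RtoC (INR (S m)) * z ^ m * h)%C) in *.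
    replace ((z + h) ^ S (S m) - z ^ S (S m) - RtoC (INR (S (S m))) * z ^ S m * h)%C
      with ((z + h) * E + RtoC (INR (S m)) * z ^ m * (h * h))%C
      by (unfold E; rewrite (S_INR (S m)), RtoC_plus; simpl Cpow; ring).
    assert (H1 : Cmod ((z + h) * E + RtoC (INR (S m)) * z ^ m * (h * h))%C
                 <= s * Cmod E + INR (S m) * s ^ m * Cmod h ^ 2).
    { eapply Rle_trans; [apply Cmod_triangle|].
      rewrite !Cmod_mult, Cmod_INR, Cmod_pow.
      apply Rplus_le_compat; [apply Rmult_le_compat_r; [apply Cmod_ge_0|exact Hzh]|].
      replace (Cmod h * Cmod h) with (Cmod h ^ 2) by ring.
      apply Rmult_le_compat_r; [apply pow2_ge_0|].
      apply Rmult_le_compat_l; [apply pos_INR|].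
      apply pow_incr; split; [apply Cmod_ge_0|exact Hz]. }
    apply Rle_trans with (s * (INR (S m) ^ 2 * s ^ m * Cmod h ^ 2 + INR (S m) * s ^ m * Cmod h ^ 2)).
    { apply Rmult_le_compat_l; [exact Hs|]. lra. }
    rewrite (S_INR (S m)). simpl (s ^ S m).
    assert (0 <= s * s ^ m * Cmod h ^ 2)
      by (apply Rmult_le_pos; [apply Rmult_le_pos; [exact Hs | now apply pow_le] | apply pow2_ge_0]).
    pose proof (pos_INR (S m)).
    replace (s * (INR (S m) ^ 2 * s ^ m * Cmod h ^ 2 + INR (S m) * s ^ m * Cmod h ^ 2))
      with ((INR (S m) ^ 2 + INR (S m)) * (s * s ^ m * Cmod h ^ 2)) by ring.
    replace ((INR (S m) + 1) ^ 2 * (s * s ^ m) * Cmod h ^ 2)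
      with ((INR (S m) + 1) ^ 2 * (s * s ^ m * Cmod h ^ 2)) by ring.
    apply Rmult_le_compat_r; [assumption|]. nra.
Qed.

(** The second-order remainders of the powers are summed term by term. Their total is O(|h|^2)
    because two multiplications of the coefficients by n preserve [disk_coef]. *)
Lemma is_derive_PS (c : nat -> C) (z : C) :
  disk_coef c -> Cmod z < 1 ->
  @is_derive C_AbsRing C_NormedModule (PS c) z (PS (dcoef c) z).
Proof.
  intros Hc Hz.
  set (s := (1 + Cmod z) / 2).
  assert (Hz0 := Cmod_ge_0 z).
  assert (Hs : 0 < s < 1) by (unfold s; lra).
  set (b := fun m => INR (S m) ^ 2 * Cmod (c (S m)) * s ^ m).
  assert (Hb : ex_series b).
  { apply ex_series_ext with (fun n => Cmod (dcoef (fun n => RtoC (INR n) * c n)%C n) * s ^ n).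
    - intros n. unfold b, dcoef. rewrite !Cmod_mult, !Cmod_INR.
      match goal with |- ?x = ?y => change (@eq R x y) end. ring.
    - apply disk_coef_abs_series; [|lra]. apply disk_coef_dcoef, disk_coef_mult_n, Hc. }
  set (K := Series b / s).
  assert (Hmain : forall h, Cmod h <= s - Cmod z ->
     Cmod (PS c (z + h) - PS c z - PS (dcoef c) z * h)%C <= K * Cmod h ^ 2).
  { intros h Hh.
    assert (Hzh : Cmod (z + h) <= s) by (eapply Rle_trans; [apply Cmod_triangle|lra]).
    assert (Hzs : Cmod z <= s) by (unfold s; lra).
    set (a := fun m => (c (S m) * ((z + h) ^ S m - z ^ S m - RtoC (INR (S m)) * z ^ m * h))%C).
    assert (Ha : @is_series C_AbsRing C_NormedModule a (PS c (z + h) - PS c z - PS (dcoef c) z * h)%C).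
    { assert (H1 := PS_correct c (z + h) Hc (Rle_lt_trans _ _ _ Hzh (proj2 Hs))).
      assert (H2 := PS_correct c z Hc Hz).
      assert (H3 := PS_correct (dcoef c) z (disk_coef_dcoef c Hc) Hz).
      assert (H4 := is_series_C_tail _ _ (is_series_C_minus _ _ _ _ H1 H2)).
      assert (H5 := is_series_C_minus _ _ _ _ H4 (is_series_C_scal h _ _ H3)).
      eapply is_series_C_ext; [| |exact H5].
      - intros n. unfold a, dcoef. ring.
      - cbv beta. simpl Cpow. ring. }
    eapply Rle_trans.
    - apply is_series_C_norm_le with (3 := Ha) (b := fun m => (Cmod h ^ 2 / s) * b m).
      + intros m. unfold a, b. rewrite Cmod_mult.
        assert (Hp := pow_second_order z h s m Hzs Hzh).
        apply Rmult_le_reg_l with s; [lra|].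
        replace (s * (Cmod h ^ 2 / s * (INR (S m) ^ 2 * Cmod (c (S m)) * s ^ m)))
          with (Cmod (c (S m)) * (INR (S m) ^ 2 * s ^ m * Cmod h ^ 2)) by (field; lra).
        rewrite <- Rmult_assoc, (Rmult_comm s), Rmult_assoc.
        apply Rmult_le_compat_l; [apply Cmod_ge_0|exact Hp].
      + now apply (ex_series_scal_l (Cmod h ^ 2 / s) b).
    - rewrite Series_scal_l. unfold K. right. field. lra. }
  apply is_derive_C_intro. intros eps Heps.
  assert (HK : 0 < Rabs K + 1) by (pose proof (Rabs_pos K); lra).
  exists (Rmin (s - Cmod z) (eps / (Rabs K + 1))). split.
  - apply Rmin_pos; [unfold s; lra|]. now apply Rdiv_lt_0_compat.
  - intros h Hh.
    eapply Rle_trans; [apply Hmain; apply Rlt_le; eapply Rlt_le_trans; [exact Hh|apply Rmin_l]|].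
    assert (Hh2 : Cmod h < eps / (Rabs K + 1)) by (eapply Rlt_le_trans; [exact Hh|apply Rmin_r]).
    assert (Hh0 := Cmod_ge_0 h).
    replace (K * Cmod h ^ 2) with (K * Cmod h * Cmod h) by ring.
    apply Rmult_le_compat_r; [exact Hh0|].
    apply Rle_trans with ((Rabs K + 1) * Cmod h).
    + apply Rmult_le_compat_r; [exact Hh0|]. pose proof (Rle_abs K); lra.
    + apply Rlt_le. apply (Rmult_lt_compat_l (Rabs K + 1)) in Hh2; [|lra].
      replace ((Rabs K + 1) * (eps / (Rabs K + 1))) with eps in Hh2 by (field; lra). exact Hh2.
Qed.

(** * Maximum principle for uniform limits of polynomials *)

Fixpoint Csum (F : nat -> C) (n : nat) : C :=
  match n with O => RtoC 0 | S m => (Csum F m + F m)%C end.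

Fixpoint Rsum (F : nat -> R) (n : nat) : R :=
  match n with O => 0 | S m => Rsum F m + F m end.

Lemma Csum_ext (F G : nat -> C) (n : nat) :
  (forall j, F j = G j) -> Csum F n = Csum G n.
Proof. intros H; induction n; simpl; [reflexivity|now rewrite IHn, H]. Qed.

Lemma Csum_plus (F G : nat -> C) (n : nat) :
  Csum (fun j => F j + G j)%C n = (Csum F n + Csum G n)%C.
Proof. induction n; simpl; [ring|rewrite IHn; ring]. Qed.

Lemma Csum_scal (k : C) (F : nat -> C) (n : nat) :
  Csum (fun j => k * F j)%C n = (k * Csum F n)%C.
Proof. induction n; simpl; [ring|rewrite IHn; ring]. Qed.

Lemma Re_Csum (F : nat -> C) (n : nat) : Re (Csum F n) = Rsum (fun j => Re (F j)) n.
Proof. induction n; simpl; [reflexivity|now rewrite <- IHn]. Qed.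

Lemma Rsum_ext (F G : nat -> R) (n : nat) :
  (forall j, F j = G j) -> Rsum F n = Rsum G n.
Proof. intros H; induction n; simpl; [reflexivity|now rewrite IHn, H]. Qed.

Lemma Rsum_le (F G : nat -> R) (n : nat) :
  (forall j, F j <= G j) -> Rsum F n <= Rsum G n.
Proof. intros H; induction n; simpl; [lra|specialize (H n); lra]. Qed.

Lemma Rsum_plus (F G : nat -> R) (n : nat) :
  Rsum (fun j => F j + G j) n = Rsum F n + Rsum G n.
Proof. induction n; simpl; [ring|rewrite IHn; ring]. Qed.

Lemma Rsum_scal (k : R) (F : nat -> R) (n : nat) :
  Rsum (fun j => k * F j) n = k * Rsum F n.
Proof. induction n; simpl; [ring|rewrite IHn; ring]. Qed.

Lemma Rsum_const (k : R) (n : nat) : Rsum (fun _ => k) n = INR n * k.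
Proof. induction n; [simpl; ring|rewrite S_INR; simpl; rewrite IHn; ring]. Qed.

Lemma Csum_geom (w : C) (n : nat) :
  ((w - 1) * Csum (fun j => w ^ j) n = w ^ n - 1)%C.
Proof.
  induction n; simpl; [ring|].
  rewrite Cmult_plus_distr_l, IHn. ring.
Qed.

(** * Roots of unity and orthogonality of powers *)

Lemma Cpow_cos_sin (x : R) (n : nat) :
  ((cos x, sin x) ^ n)%C = (cos (INR n * x), sin (INR n * x)).
Proof.
  induction n; [simpl; rewrite Rmult_0_l, cos_0, sin_0; reflexivity|].
  rewrite Cpow_S, IHn, S_INR, Rmult_plus_distr_r, Rmult_1_l, cos_plus, sin_plus.
  unfold Cmult; simpl. f_equal; ring.
Qed.

Definition unity_root (N : nat) : C := (cos (2 * PI / INR N), sin (2 * PI / INR N)).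

Lemma unity_root_pow_self (N : nat) : (0 < N)%nat -> (unity_root N ^ N)%C = RtoC 1.
Proof.
  intros HN. unfold unity_root. rewrite Cpow_cos_sin.
  assert (0 < INR N) by now apply lt_0_INR.
  replace (INR N * (2 * PI / INR N)) with (2 * PI) by (field; lra).
  now rewrite cos_2PI, sin_2PI.
Qed.

Lemma unity_root_pow_neq (N m : nat) : (0 < m < N)%nat -> (unity_root N ^ m)%C <> RtoC 1.
Proof.
  intros Hm H. unfold unity_root in H. rewrite Cpow_cos_sin in H.
  assert (Hm0 : 0 < INR m) by (apply lt_0_INR; lia).
  assert (HmN : INR m < INR N) by (apply lt_INR; lia).
  (* Half the argument of the m-th power: 1 - cos (2 y) = 2 (sin y)^2 is positive since 0 < y <
     PI. *)
  set (y := PI * (INR m / INR N)).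
  replace (INR m * (2 * PI / INR N)) with (2 * y) in H by (unfold y; field; lra).
  assert (Hq : 0 < INR m / INR N < 1).
  { split; [apply Rdiv_lt_0_compat; lra|].
    apply Rmult_lt_reg_r with (INR N); [lra|]. unfold Rdiv. rewrite Rmult_assoc, Rinv_l; lra. }
  assert (Hy : 0 < y < PI) by (unfold y; pose proof PI_RGT_0; split; nra).
  injection H as Hc _. rewrite cos_2a_sin in Hc.
  assert (0 < sin y) by (apply sin_gt_0; lra). nra.
Qed.

Definition node (r : R) (N j : nat) : C := (RtoC r * unity_root N ^ j)%C.

Lemma Cmod_node (r : R) (N j : nat) : 0 <= r -> Cmod (node r N j) = r.
Proof.
  intros Hr. unfold node.
  assert (Cmod (unity_root N) = 1).
  { unfold Cmod. replace (_ + _) with 1; [apply sqrt_1|].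
    pose proof (sin2_cos2 (2 * PI / INR N)) as H. unfold Rsqr in H. simpl. lra. }
  rewrite Cmod_mult, Cmod_pow, H, pow1, Cmod_R, Rabs_pos_eq; lra.
Qed.

(** A geometric sum whose ratio, the m-th power of the root, differs from 1 while its N-th power is
    1. *)
Lemma Csum_node_pow (r : R) (N m : nat) :
  (0 < m < N)%nat -> Csum (fun j => node r N j ^ m)%C N = RtoC 0.
Proof.
  intros Hm.
  rewrite (Csum_ext _ (fun j => RtoC r ^ m * (unity_root N ^ m) ^ j)%C).
  2:{ intros j. unfold node. rewrite Cpow_mult_l, <- !Cpow_mult_r, (Nat.mul_comm j m). reflexivity. }
  rewrite Csum_scal.
  assert (H := Csum_geom (unity_root N ^ m) N).
  rewrite <- Cpow_mult_r, Nat.mul_comm, Cpow_mult_r, unity_root_pow_self, Cpow_1_l in H by lia.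
  assert (Hne : (unity_root N ^ m - 1)%C <> RtoC 0).
  { intros E. apply (unity_root_pow_neq N m Hm).
    replace (unity_root N ^ m)%C with ((unity_root N ^ m - 1) + 1)%C by ring. rewrite E. ring. }
  destruct (Ceq_dec (Csum (fun j => (unity_root N ^ m) ^ j)%C N) 0) as [E|E].
  - transitivity (RtoC r ^ m * 0)%C; [exact (f_equal (Cmult (RtoC r ^ m)) E)|ring].
  - exfalso. apply (Cmult_neq_0 _ _ Hne E). rewrite H. ring.
Qed.

(** * Polynomials as coefficient lists and the discrete Parseval identity *)

Fixpoint peval (l : list C) (z : C) : C :=
  match l with [] => RtoC 0 | a :: l' => (a + z * peval l' z)%C end.

(** The squared H^2 norm on the circle of radius r, that is the sum of |a_k|^2 r^(2 k), in Horner
    form so that inductions can peel off the constant coefficient together with [peval]. *)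
Fixpoint pnorm2 (r : R) (l : list C) : R :=
  match l with [] => 0 | a :: l' => Cmod a ^ 2 + r ^ 2 * pnorm2 r l' end.

Fixpoint padd (l m : list C) : list C :=
  match l, m with
  | [], _ => m
  | _, [] => l
  | a :: l', b :: m' => (a + b)%C :: padd l' m'
  end.

Fixpoint pmul (l m : list C) : list C :=
  match l with
  | [] => []
  | a :: l' => padd (map (Cmult a) m) (RtoC 0 :: pmul l' m)
  end.

Fixpoint ppow (l : list C) (n : nat) : list C :=
  match n with O => [RtoC 1] | S k => pmul l (ppow l k) end.

Lemma peval_padd (l m : list C) (z : C) : peval (padd l m) z = (peval l z + peval m z)%C.
Proof.
  revert m; induction l as [|a l IH]; intros m; simpl; [ring|].
  destruct m as [|b m]; simpl; [ring|]. rewrite IH. ring.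
Qed.

Lemma peval_map (a : C) (m : list C) (z : C) : peval (map (Cmult a) m) z = (a * peval m z)%C.
Proof. induction m as [|b m IH]; simpl; [ring|]. rewrite IH. ring. Qed.

Lemma peval_pmul (l m : list C) (z : C) : peval (pmul l m) z = (peval l z * peval m z)%C.
Proof.
  induction l as [|a l IH]; simpl; [ring|].
  rewrite peval_padd, peval_map. simpl. rewrite IH. ring.
Qed.

Lemma peval_ppow (l : list C) (n : nat) (z : C) : peval (ppow l n) z = (peval l z ^ n)%C.
Proof. induction n; simpl; [ring|]. rewrite peval_pmul, IHn. reflexivity. Qed.

Lemma peval_bounded (r : R) (l : list C) :
  0 <= r -> exists B, 0 <= B /\ forall z, Cmod z <= r -> Cmod (peval l z) <= B.
Proof.
  intros Hr. induction l as [|a l [B [HB IH]]]; simpl.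
  - exists 0. split; [lra|]. intros; rewrite Cmod_0; lra.
  - exists (Cmod a + r * B). pose proof (Cmod_ge_0 a). split; [nra|].
    intros z Hz. eapply Rle_trans; [apply Cmod_triangle|]. rewrite Cmod_mult.
    apply Rplus_le_compat_l. apply Rmult_le_compat; auto using Cmod_ge_0.
Qed.

(** All exponents that occur lie strictly between 0 and N, so each monomial averages to zero. This
    is an exact, finite form of the mean value property. *)
Lemma Csum_node_poly (r : R) (N : nat) (l : list C) (m : nat) :
  (0 < m)%nat -> (m + length l <= N)%nat ->
  Csum (fun j => node r N j ^ m * peval l (node r N j))%C N = RtoC 0.
Proof.
  revert m; induction l as [|a l IH]; intros m Hm Hl; simpl in *.
  - rewrite (Csum_ext _ (fun j => 0 * node r N j ^ m)%C) by (intros; ring).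
    rewrite Csum_scal. ring.
  - rewrite (Csum_ext _ (fun j => a * node r N j ^ m
                + node r N j ^ S m * peval l (node r N j))%C)
      by (intros; simpl; ring).
    rewrite Csum_plus, Csum_scal, Csum_node_pow, IH by lia. ring.
Qed.

Lemma Cmod_plus_sqr (z w : C) :
  Cmod (z + w) ^ 2 = Cmod z ^ 2 + Cmod w ^ 2 + 2 * Re (Cconj z * w).
Proof. rewrite !Cmod2_alt. unfold Re, Im, Cconj; simpl. ring. Qed.

(** Peeling off the constant coefficient a writes the value as a + z l(z); the cross term 2 Re
    (conj(a) z l(z)) averages to zero over the nodes, provided that there are at least as many nodes
    as coefficients. *)
Lemma parseval (r : R) (N : nat) (l : list C) :
  0 <= r -> (length l <= N)%nat ->
  Rsum (fun j => Cmod (peval l (node r N j)) ^ 2) N = INR N * pnorm2 r l.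
Proof.
  intros Hr. induction l as [|a l IH]; simpl pnorm2; intros Hl; simpl in Hl.
  - rewrite (Rsum_ext _ (fun _ => 0)); [rewrite Rsum_const; ring|].
    intros; simpl; rewrite Cmod_0; ring.
  - rewrite (Rsum_ext _ (fun j => (Cmod a ^ 2 + r ^ 2 * Cmod (peval l (node r N j)) ^ 2)
        + 2 * Re (Cconj a * (node r N j ^ 1 * peval l (node r N j))))).
    2:{ intros j. simpl peval. rewrite Cmod_plus_sqr, Cmod_mult, Cmod_node, Cpow_1_r by exact Hr. ring. }
    rewrite !Rsum_plus, Rsum_const, Rsum_scal, IH by lia.
    rewrite Rsum_scal, <- Re_Csum, Csum_scal, Csum_node_poly by lia.
    replace (Re (Cconj a * 0)) with 0 by (unfold Re; simpl; ring). ring.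
Qed.

(** Cauchy-Schwarz between the sequences a_k r^k and x^k, where 1 / (1 - x^2) is the sum of x^(2
    k). *)
Lemma peval_le_pnorm2 (r x : R) (l : list C) (w : C) :
  0 <= r -> 0 <= x < 1 -> Cmod w = x * r ->
  Cmod (peval l w) ^ 2 * (1 - x ^ 2) <= pnorm2 r l.
Proof.
  intros Hr Hx Hw. induction l as [|a l IH]; simpl peval; simpl pnorm2.
  - rewrite Cmod_0. lra.
  - set (q := Cmod (peval l w)) in *.
    assert (Hq : 0 <= q) by apply Cmod_ge_0.
    assert (Ha : 0 <= Cmod a) by apply Cmod_ge_0.
    assert (Hxx : 0 <= 1 - x ^ 2) by nra.
    assert (H : Cmod (a + w * peval l w) <= Cmod a + x * (r * q)).
    { eapply Rle_trans; [apply Cmod_triangle|]. rewrite Cmod_mult, Hw. fold q. lra. }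
    assert (Hp := Cmod_ge_0 (a + w * peval l w)).
    apply Rle_trans with ((Cmod a + x * (r * q)) ^ 2 * (1 - x ^ 2)).
    + apply Rmult_le_compat_r; [exact Hxx|]. apply pow_incr. lra.
    + apply Rle_trans with (Cmod a ^ 2 + (r * q) ^ 2 * (1 - x ^ 2)).
      (* With A = |a| and Q = r q, this square is exactly the difference A^2 + Q^2 (1 - x^2) - (A +
         x Q)^2 (1 - x^2). *)
      * assert (0 <= (x * Cmod a - r * q * (1 - x ^ 2)) ^ 2) by apply pow2_ge_0. lra.
      * assert (r ^ 2 * (q ^ 2 * (1 - x ^ 2)) <= r ^ 2 * pnorm2 r l)
          by (apply Rmult_le_compat_l; [apply pow2_ge_0|exact IH]).
        lra.
Qed.

Lemma pnorm2_le (r M : R) (l : list C) :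
  0 <= r -> 0 <= M -> (forall z, Cmod z = r -> Cmod (peval l z) <= M) -> pnorm2 r l <= M ^ 2.
Proof.
  intros Hr HM H.
  set (N := S (length l)).
  assert (HN : 0 < INR N) by (apply lt_0_INR; unfold N; lia).
  apply Rmult_le_reg_l with (INR N); [exact HN|].
  rewrite <- (parseval r N l Hr) by (unfold N; lia).
  rewrite <- Rsum_const. apply Rsum_le. intros j.
  apply pow_incr; split; [apply Cmod_ge_0|]. apply H. now apply Cmod_node.
Qed.

(* Cauchy-Schwarz gives the bound up to a constant factor depending on w only;
   applied to the powers of the polynomial it yields the sharp bound. *)
Lemma poly_max_principle (r M : R) (l : list C) (w : C) :
  0 <= r -> 0 <= M -> (forall z, Cmod z = r -> Cmod (peval l z) <= M) ->
  Cmod w <= r -> Cmod (peval l w) <= M.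
Proof.
  intros Hr HM H Hw.
  destruct (Rle_lt_or_eq_dec _ _ Hw) as [Hlt|Heq]; [|now apply H].
  assert (Hw0 := Cmod_ge_0 w).
  set (x := Cmod w / r).
  assert (Hxr : Cmod w = x * r) by (unfold x; field; lra).
  assert (Hx : 0 <= x < 1).
  { split; [apply Rdiv_le_0_compat; lra|]. apply Rmult_lt_reg_r with r; lra. }
  assert (Hn : forall n, (Cmod (peval l w) ^ 2) ^ n * (1 - x ^ 2) <= (M ^ 2) ^ n).
  { intros n. rewrite <- !pow_mult, !(Nat.mul_comm 2), !pow_mult, <- Cmod_pow, <- peval_ppow.
    eapply Rle_trans; [now apply peval_le_pnorm2 with (r := r)|].
    apply pnorm2_le; [exact Hr|now apply pow_le|].
    intros z Hz. rewrite peval_ppow, Cmod_pow. apply pow_incr.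
    split; [apply Cmod_ge_0|now apply H]. }
  apply Rnot_lt_le; intro Hlt'.
  set (A := Cmod (peval l w) ^ 2) in *. set (B := M ^ 2) in *.
  assert (HB : 0 <= B) by apply pow2_ge_0.
  assert (HAB : B < A) by (unfold A, B; nra).
  set (d := 1 - x ^ 2) in *. assert (Hd : 0 < d) by (unfold d; nra).
  (* For B > 0 the powers of A / B > 1 eventually exceed 1 / d, against [Hn]; for B = 0 the quotient
     is meaningless, but the first power already gives a contradiction. *)
  destruct (Rle_lt_or_eq_dec _ _ HB) as [HB0|HB0].
  - set (y := A / B).
    assert (Hy : 1 < y) by (unfold y; apply Rmult_lt_reg_r with B; [lra|field_simplify; lra]).
    destruct (Pow_x_infinity y) with (b := / d + 1) as [N HN]; [rewrite Rabs_pos_eq; lra|].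
    specialize (HN N (le_n _)). specialize (Hn N).
    rewrite Rabs_pos_eq in HN by (apply pow_le; lra).
    replace A with (y * B) in Hn by (unfold y; field; lra).
    rewrite Rpow_mult_distr in Hn.
    assert (HBN : 0 < B ^ N) by now apply pow_lt.
    assert (y ^ N * d <= 1) by (apply Rmult_le_reg_r with (B ^ N); lra).
    apply Rge_le in HN. apply (Rmult_le_compat_r d) in HN; [|lra].
    rewrite Rmult_plus_distr_r, Rinv_l in HN by lra. lra.
  - specialize (Hn 1%nat). rewrite !pow_1 in Hn. nra.
Qed.

(** The class on which the maximum principle is proved. It is closed under products and under 1 / (1
    - u), so quotients can be treated without expanding them into power series. *)
Definition poly_approx (r : R) (h : C -> C) : Prop :=
  forall eps, 0 < eps -> exists l, forall z, Cmod z <= r -> Cmod (h z - peval l z)%C <= eps.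

Lemma poly_approx_bounded (r : R) (h : C -> C) :
  0 <= r -> poly_approx r h -> exists B, 0 <= B /\ forall z, Cmod z <= r -> Cmod (h z) <= B.
Proof.
  intros Hr Hh. destruct (Hh 1 Rlt_0_1) as [l Hl].
  destruct (peval_bounded r l Hr) as [B [HB0 HB]].
  exists (B + 1). split; [lra|]. intros z Hz.
  pose proof (Cmod_triangle_rev (h z) (peval l z)). specialize (Hl z Hz). specialize (HB z Hz). lra.
Qed.

Lemma max_principle (r M : R) (h : C -> C) (w : C) :
  0 <= r -> 0 <= M -> poly_approx r h -> (forall z, Cmod z = r -> Cmod (h z) <= M) ->
  Cmod w <= r -> Cmod (h w) <= M.
Proof.
  intros Hr HM Hh H Hw. apply le_epsilon. intros eps Heps.
  destruct (Hh (eps / 2)) as [l Hl]; [lra|].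
  assert (Hp : Cmod (peval l w) <= M + eps / 2).
  { apply poly_max_principle with r; [exact Hr|lra| |exact Hw].
    intros z Hz. pose proof (Cmod_triangle_rev (peval l z) (h z)).
    rewrite Cmod_minus_sym in H0. specialize (Hl z (Req_le _ _ Hz)). specialize (H z Hz). lra. }
  pose proof (Cmod_triangle_rev (h w) (peval l w)). specialize (Hl w Hw). lra.
Qed.

Lemma poly_approx_const (r : R) (k : C) : poly_approx r (fun _ => k).
Proof.
  intros eps Heps. exists [k]. intros z _. simpl.
  replace (k - (k + z * 0))%C with (RtoC 0) by ring. rewrite Cmod_0. lra.
Qed.

Lemma poly_approx_plus (r : R) (h k : C -> C) :
  poly_approx r h -> poly_approx r k -> poly_approx r (fun z => h z + k z)%C.
Proof.
  intros Hh Hk eps Heps.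
  destruct (Hh (eps / 2)) as [l Hl]; [lra|]. destruct (Hk (eps / 2)) as [m Hm]; [lra|].
  exists (padd l m). intros z Hz. rewrite peval_padd.
  replace (h z + k z - (peval l z + peval m z))%C with ((h z - peval l z) + (k z - peval m z))%C by ring.
  eapply Rle_trans; [apply Cmod_triangle|]. specialize (Hl z Hz). specialize (Hm z Hz). lra.
Qed.

Lemma poly_approx_mult (r : R) (h k : C -> C) :
  0 <= r -> poly_approx r h -> poly_approx r k -> poly_approx r (fun z => h z * k z)%C.
Proof.
  intros Hr Hh Hk eps Heps.
  destruct (poly_approx_bounded r k Hr Hk) as [B [HB0 HB]].
  destruct (Hh (eps / 2 / (B + 1))) as [l Hl]; [apply Rdiv_lt_0_compat; lra|].
  destruct (peval_bounded r l Hr) as [D [HD0 HD]].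
  destruct (Hk (eps / 2 / (D + 1))) as [m Hm]; [apply Rdiv_lt_0_compat; lra|].
  exists (pmul l m). intros z Hz. rewrite peval_pmul.
  replace (h z * k z - peval l z * peval m z)%C
    with ((h z - peval l z) * k z + peval l z * (k z - peval m z))%C by ring.
  eapply Rle_trans; [apply Cmod_triangle|]. rewrite !Cmod_mult.
  specialize (Hl z Hz). specialize (Hm z Hz). specialize (HB z Hz). specialize (HD z Hz).
  assert (Cmod (h z - peval l z) * Cmod (k z) <= eps / 2 / (B + 1) * (B + 1))
    by (apply Rmult_le_compat; auto using Cmod_ge_0; lra).
  assert (Cmod (peval l z) * Cmod (k z - peval m z) <= (D + 1) * (eps / 2 / (D + 1)))
    by (apply Rmult_le_compat; auto using Cmod_ge_0; lra).
  replace (eps / 2 / (B + 1) * (B + 1)) with (eps / 2) in * by (field; lra).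
  replace ((D + 1) * (eps / 2 / (D + 1))) with (eps / 2) in * by (field; lra). lra.
Qed.

Lemma poly_approx_limit (r : R) (h : C -> C) :
  (forall eps, 0 < eps -> exists k, poly_approx r k /\
     forall z, Cmod z <= r -> Cmod (h z - k z)%C <= eps) -> poly_approx r h.
Proof.
  intros H eps Heps. destruct (H (eps / 2)) as [k [Hk Hhk]]; [lra|].
  destruct (Hk (eps / 2)) as [l Hl]; [lra|].
  exists l. intros z Hz.
  replace (h z - peval l z)%C with ((h z - k z) + (k z - peval l z))%C by ring.
  eapply Rle_trans; [apply Cmod_triangle|]. specialize (Hl z Hz). specialize (Hhk z Hz). lra.
Qed.

Lemma C1_minus_neq_0 (u : C) : Cmod u < 1 -> (1 - u)%C <> RtoC 0.
Proof.
  intros Hu E. assert (u = RtoC 1) by (replace u with (1 - (1 - u))%C by ring; rewrite E; ring).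
  subst u. rewrite Cmod_1 in Hu. lra.
Qed.

(** The partial sums of the geometric series in u stay in the class, and the remainder u^(n+1) / (1
    - u) is at most q^(n+1) / (1 - q) in modulus, uniformly on the disk. *)
Lemma poly_approx_geom (r q : R) (u : C -> C) :
  0 <= r -> 0 <= q < 1 -> poly_approx r u -> (forall z, Cmod z <= r -> Cmod (u z) <= q) ->
  poly_approx r (fun z => / (1 - u z))%C.
Proof.
  intros Hr Hq Hu Hb.
  set (S_ := fix S_ n z := match n with O => RtoC 1 | S k => (1 + u z * S_ k z)%C end).
  assert (HS : forall n, poly_approx r (S_ n)).
  { induction n; simpl; [apply poly_approx_const|].
    apply poly_approx_plus; [apply poly_approx_const|]. now apply poly_approx_mult. }
  assert (HE : forall n z, Cmod z <= r -> (/ (1 - u z) - S_ n z = u z ^ S n * / (1 - u z))%C).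
  { intros n z Hz. assert (Hne : (1 - u z)%C <> RtoC 0) by (apply C1_minus_neq_0; specialize (Hb z Hz); lra).
    induction n; [simpl; field; exact Hne|].
    simpl S_. replace (S_ n z) with (/ (1 - u z) - u z ^ S n * / (1 - u z))%C by (rewrite <- IHn; ring).
    rewrite (Cpow_S (u z) (S n)). field. exact Hne. }
  apply poly_approx_limit. intros eps Heps.
  destruct (pow_lt_1_zero q) with (y := eps * (1 - q)) as [N HN];
    [rewrite Rabs_pos_eq; lra|apply Rmult_lt_0_compat; lra|].
  exists (S_ N). split; [apply HS|]. intros z Hz. rewrite HE by exact Hz.
  specialize (HN (S N) (le_S _ _ (le_n _))).
  rewrite Rabs_pos_eq in HN by (apply pow_le; lra).
  specialize (Hb z Hz).
  assert (Hne : (1 - u z)%C <> RtoC 0) by (apply C1_minus_neq_0; lra).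
  rewrite Cmod_mult, Cmod_pow, Cmod_inv by exact Hne.
  assert (Hl : 1 - q <= Cmod (1 - u z)).
  { pose proof (Cmod_triangle_rev 1 (u z)). rewrite Cmod_1 in H. lra. }
  apply Rmult_le_reg_r with (Cmod (1 - u z)); [lra|].
  rewrite Rmult_assoc, Rinv_l, Rmult_1_r by lra.
  apply Rle_trans with (q ^ S N); [apply pow_incr; split; [apply Cmod_ge_0|exact Hb]|].
  apply Rle_trans with (eps * (1 - q)); [lra|]. apply Rmult_le_compat_l; lra.
Qed.

Fixpoint plist (c : nat -> C) (n : nat) : list C :=
  match n with O => [c O] | S m => c O :: plist (fun k => c (S k)) m end.

Lemma sum_n_C_shift (c : nat -> C) (z : C) (n : nat) :
  sum_n (fun k => c k * z ^ k)%C (S n)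
  = (c O + z * sum_n (fun k => c (S k) * z ^ k)%C n)%C.
Proof.
  induction n.
  - rewrite sum_Sn, !sum_O. change plus with Cplus. simpl Cpow.
    match goal with |- ?x = ?y => change (@eq C x y) end. ring.
  - rewrite sum_Sn, IHn, sum_Sn. change plus with Cplus.
    generalize (sum_n (fun k => c (S k) * z ^ k)%C n : C). intros s. rewrite !Cpow_S.
    match goal with |- ?x = ?y => change (@eq C x y) end. ring.
Qed.

Lemma peval_plist (c : nat -> C) (n : nat) (z : C) :
  peval (plist c n) z = sum_n (fun k => c k * z ^ k)%C n.
Proof.
  revert c; induction n; intros c.
  - rewrite sum_O. simpl. ring.
  - rewrite sum_n_C_shift. simpl. rewrite IHn. reflexivity.
Qed.

Lemma PS_plist_unif (c : nat -> C) (r eps : R) :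
  disk_coef c -> 0 <= r < 1 -> 0 < eps ->
  exists N, forall n, (N <= n)%nat -> forall z, Cmod z <= r ->
    Cmod (PS c z - peval (plist c n) z)%C <= eps.
Proof.
  intros Hc Hr Heps. destruct (PS_unif c r eps Hc Hr Heps) as [N HN].
  exists N. intros n Hn z Hz. rewrite peval_plist. now apply HN.
Qed.

Lemma poly_approx_PS (c : nat -> C) (r : R) :
  disk_coef c -> 0 <= r < 1 -> poly_approx r (PS c).
Proof.
  intros Hc Hr eps Heps. destruct (PS_plist_unif c r eps Hc Hr Heps) as [N HN].
  exists (plist c N). now apply HN.
Qed.

(** * Schwarz-Pick inequality on the boundary *)

Lemma PS_shift (c : nat -> C) (z : C) :
  disk_coef c -> Cmod z < 1 -> (PS c z = c O + z * PS (fun n => c (S n)) z)%C.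
Proof.
  intros Hc Hz. apply CSeries_unique.
  assert (H := is_series_C_scal z _ _ (PS_correct _ z (disk_coef_shift c Hc) Hz)).
  eapply is_series_C_ext; [reflexivity| |apply is_series_C_cons; eapply is_series_C_ext; [|reflexivity|exact H]].
  - cbv beta. simpl Cpow. ring.
  - intros n. cbv beta. simpl Cpow. ring.
Qed.

Lemma Cmod_mobius (a : R) (w : C) :
  Cmod (1 - RtoC a * w)%C ^ 2 - Cmod (w - RtoC a)%C ^ 2 = (1 - a ^ 2) * (1 - Cmod w ^ 2).
Proof. rewrite !Cmod2_alt. unfold Re, Im; simpl. ring. Qed.

(** With g - a = z k, the maximum principle is applied to k / (1 - a g): on the circle |z| = r its
    modulus is at most 1 / r because (w - a) / (1 - a w) maps the closed unit disk into itself. Only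
    a bound on the closed disk of radius r is assumed, whence the factor r; when |w| = r and |g(w)|
    = 1 the inequality becomes an equality. *)
Lemma schwarz_pick (c : nat -> C) (a r : R) (w : C) :
  disk_coef c -> c O = RtoC a -> 0 <= a < 1 -> 0 < r < 1 ->
  (forall z, Cmod z <= r -> Cmod (PS c z) <= 1) -> Cmod w <= r ->
  r * Cmod (PS c w - RtoC a)%C <= Cmod w * Cmod (1 - RtoC a * PS c w)%C.
Proof.
  intros Hc Hc0 Ha Hr Hb Hw.
  set (g := PS c) in *. set (k := PS (fun n => c (S n))).
  assert (Hg : forall z, Cmod z <= r -> (g z - RtoC a = z * k z)%C).
  { intros z Hz. unfold g. rewrite PS_shift by (exact Hc || lra). rewrite Hc0. fold k. ring. }
  assert (Hag : forall z, Cmod z <= r -> Cmod (RtoC a * g z) <= a).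
  { intros z Hz. rewrite Cmod_mult, Cmod_R, Rabs_pos_eq by lra.
    specialize (Hb z Hz). pose proof (Cmod_ge_0 (g z)). nra. }
  assert (Hne : forall z, Cmod z <= r -> (1 - RtoC a * g z)%C <> RtoC 0).
  { intros z Hz. apply C1_minus_neq_0. specialize (Hag z Hz). lra. }
  assert (Hpos : forall z, Cmod z <= r -> 0 < Cmod (1 - RtoC a * g z)).
  { intros z Hz. now apply Cmod_gt_0, Hne. }
  assert (HA : poly_approx r (fun z => k z * / (1 - RtoC a * g z))%C).
  { apply poly_approx_mult; [lra| |].
    - apply poly_approx_PS; [now apply disk_coef_shift|lra].
    - apply (poly_approx_geom r a (fun z => RtoC a * g z)%C); [lra|lra| |exact Hag].
      apply (poly_approx_mult r (fun _ => RtoC a)); [lra|apply poly_approx_const|].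
      apply poly_approx_PS; [exact Hc|lra]. }
  assert (HM : Cmod (k w * / (1 - RtoC a * g w))%C <= / r).
  { apply (max_principle r (/ r) _ w) with (3 := HA); [lra| | |exact Hw].
    - left. apply Rinv_0_lt_compat; lra.
    - intros z Hz. assert (Hz' : Cmod z <= r) by lra.
      rewrite Cmod_mult, Cmod_inv by now apply Hne.
      specialize (Hpos z Hz').
      apply Rmult_le_reg_r with (Cmod (1 - RtoC a * g z)); [exact Hpos|].
      rewrite Rmult_assoc, Rinv_l, Rmult_1_r by lra.
      apply Rmult_le_reg_l with r; [lra|]. rewrite <- Rmult_assoc, Rinv_r, Rmult_1_l by lra.
      rewrite <- Hz at 1. rewrite <- Cmod_mult, <- Hg by exact Hz'.
      apply Cmod_le_of_sqr; [lra|].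
      assert (E := Cmod_mobius a (g z)). specialize (Hb z Hz').
      pose proof (Cmod_ge_0 (g z)).
      assert (0 <= (1 - a ^ 2) * (1 - Cmod (g z) ^ 2)) by (apply Rmult_le_pos; nra). lra. }
  rewrite Hg by exact Hw. rewrite Cmod_mult.
  rewrite Cmod_mult, Cmod_inv in HM by now apply Hne.
  specialize (Hpos w Hw).
  apply (Rmult_le_compat_r (r * Cmod (1 - RtoC a * g w))) in HM; [|nra].
  replace (Cmod (k w) * / Cmod (1 - RtoC a * g w) * (r * Cmod (1 - RtoC a * g w)))
    with (r * Cmod (k w)) in HM by (field; lra).
  replace (/ r * (r * Cmod (1 - RtoC a * g w))) with (Cmod (1 - RtoC a * g w)) in HM by (field; lra).
  pose proof (Cmod_ge_0 w). nra.
Qed.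

(** Reduces a complex derivative to two real ones, so that a real expression in the values of f
    along a segment can be differentiated. *)
Lemma derivative_along_line (f : C -> C) (z l v : C) :
  @is_derive C_AbsRing C_NormedModule f z l ->
  is_derive (fun s : R => Re (f (z + RtoC s * v)%C)) 0 (Re (l * v)) /\
  is_derive (fun s : R => Im (f (z + RtoC s * v)%C)) 0 (Im (l * v)).
Proof.
  intros Hf.
  assert (H : forall eps, 0 < eps -> exists d : posreal, forall s : R, s <> 0 -> Rabs s < d ->
     Cmod (f (z + RtoC s * v) - f z - RtoC s * (l * v))%C < eps * Rabs s).
  { intros eps Heps. pose proof (Cmod_ge_0 v) as Hv.
    destruct (is_derive_C_elim f z l Hf (eps / 2 / (Cmod v + 1))) as [d [Hd H]];
      [apply Rdiv_lt_0_compat; lra|].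
    assert (Hd' : 0 < d / (Cmod v + 1)) by (apply Rdiv_lt_0_compat; lra).
    exists (mkposreal _ Hd'). intros s Hs0 Hs. simpl in Hs.
    assert (Hs1 : 0 < Rabs s) by now apply Rabs_pos_lt.
    assert (Hc : Cmod (RtoC s * v) = Rabs s * Cmod v) by now rewrite Cmod_mult, Cmod_R.
    replace (RtoC s * (l * v))%C with (l * (RtoC s * v))%C by ring.
    eapply Rle_lt_trans; [apply H|].
    - rewrite Hc. apply Rle_lt_trans with (Rabs s * (Cmod v + 1)); [nra|].
      apply (Rmult_lt_compat_r (Cmod v + 1)) in Hs; [|lra].
      replace (d / (Cmod v + 1) * (Cmod v + 1)) with d in Hs by (field; lra). exact Hs.
    - rewrite Hc.
      apply Rle_lt_trans with (eps / 2 / (Cmod v + 1) * (Rabs s * (Cmod v + 1))).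
      + apply Rmult_le_compat_l; [left; apply Rdiv_lt_0_compat; lra|nra].
      + replace (eps / 2 / (Cmod v + 1) * (Rabs s * (Cmod v + 1))) with (eps / 2 * Rabs s) by (field; lra).
        nra. }
  assert (E0 : (z + RtoC (0 + 0) * v)%C = z) by (rewrite Rplus_0_r; ring).
  split; apply is_derive_Reals; intros eps Heps; destruct (H eps Heps) as [d Hd]; exists d;
    intros s Hs0 Hs; specialize (Hd s Hs0 Hs);
    assert (Hs1 : 0 < Rabs s) by (now apply Rabs_pos_lt);
    rewrite Rplus_0_l;
    replace (z + RtoC 0 * v)%C with z by ring;
    (apply Rmult_lt_reg_r with (Rabs s); [exact Hs1|]); rewrite <- Rabs_mult;
    (eapply Rle_lt_trans; [|exact Hd]).
  - replace ((Re (f (z + RtoC s * v)%C) - Re (f z)) / s - Re (l * v)) with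
      (Re (f (z + RtoC s * v) - f z - RtoC s * (l * v))%C / s)
      by (unfold Re; simpl; field; exact Hs0).
    unfold Rdiv. rewrite Rmult_assoc, Rinv_l, Rmult_1_r by exact Hs0. apply re_le_Cmod.
  - replace ((Im (f (z + RtoC s * v)%C) - Im (f z)) / s - Im (l * v)) with
      (Im (f (z + RtoC s * v) - f z - RtoC s * (l * v))%C / s)
      by (unfold Im; simpl; field; exact Hs0).
    unfold Rdiv. rewrite Rmult_assoc, Rinv_l, Rmult_1_r by exact Hs0.
    eapply Rle_trans; [apply Rmax_r|apply Rmax_Cmod].
Qed.

Lemma derive_nonneg_right (F : R -> R) (l d : R) :
  is_derive F 0 l -> 0 < d -> F 0 = 0 -> (forall s, 0 < s < d -> 0 <= F s) -> 0 <= l.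
Proof.
  intros HF Hd H0 Hpos. apply is_derive_Reals in HF.
  apply Rnot_lt_le; intro Hl.
  destruct (HF (- l)) as [e He]; [lra|].
  pose proof (cond_pos e).
  set (s := Rmin (d / 2) (e / 2)).
  assert (Hs : 0 < s) by (apply Rmin_pos; lra).
  assert (Hsd : s <= d / 2) by apply Rmin_l. assert (Hse : s <= e / 2) by apply Rmin_r.
  specialize (He s). rewrite Rplus_0_l, H0, Rabs_pos_eq in He by lra.
  specialize (He ltac:(lra) ltac:(lra)). specialize (Hpos s ltac:(lra)).
  apply Rabs_lt_between in He.
  assert (0 <= (F s - 0) / s) by (apply Rdiv_le_0_compat; lra). lra.
Qed.

(* The Schwarz-Pick inequality is an equality at z, so its derivative along z (1 + s v),
   which points into the disk when Re v < 0, has a sign. *)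
Lemma boundary_derivative (c : nat -> C) (a : R) (z v : C) :
  disk_coef c -> c O = RtoC a -> 0 <= a < 1 -> 0 < Cmod z < 1 ->
  (forall w, Cmod w <= Cmod z -> Cmod (PS c w) <= 1) -> Cmod (PS c z) = 1 -> Re v < 0 ->
  (1 - a ^ 2) * Re (Cconj (PS c z) * (z * PS (dcoef c) z) * v)
    <= Re v * Cmod (1 - RtoC a * PS c z)%C ^ 2.
Proof.
  intros Hc Hc0 Ha Hz Hb Hg1 Hv.
  set (l := PS (dcoef c) z). set (r := Cmod z) in *.
  destruct (derivative_along_line (PS c) z l (z * v) (is_derive_PS c z Hc (proj2 Hz))) as [Hx Hy].
  set (x := fun s : R => Re (PS c (z + RtoC s * (z * v))%C)) in *.
  set (y := fun s : R => Im (PS c (z + RtoC s * (z * v))%C)) in *.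
  assert (E0 : (z + RtoC 0 * (z * v))%C = z) by ring.
  assert (Ex : x 0 = Re (PS c z)) by (unfold x; now rewrite E0).
  assert (Ey : y 0 = Im (PS c z)) by (unfold y; now rewrite E0).
  assert (Hone : x 0 ^ 2 + y 0 ^ 2 = 1) by (rewrite Ex, Ey, <- Cmod2_alt, Hg1; ring).
  (* The two sides of Schwarz-Pick at z (1 + s v), squared, subtracted and divided by r^2. [F]
     vanishes at 0 and is nonnegative for small s > 0, so its derivative at 0 is nonnegative. *)
  set (F := fun s => ((1 + s * Re v) ^ 2 + (s * Im v) ^ 2) * ((1 - a * x s) ^ 2 + (a * y s) ^ 2)
                     - ((x s - a) ^ 2 + y s ^ 2)).
  set (lx := Re (l * (z * v))) in *. set (ly := Im (l * (z * v))) in *.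
  assert (HF : is_derive F 0 (2 * (Re v * ((1 - a * x 0) ^ 2 + (a * y 0) ^ 2)
                 - (1 - a ^ 2) * (x 0 * lx + y 0 * ly)))).
  { unfold F. auto_derive.
    - repeat split; trivial; eexists; (exact Hx || exact Hy).
    - assert (Dx : Derive (fun s => x s) 0 = lx) by exact (is_derive_unique x 0 lx Hx).
      assert (Dy : Derive (fun s => y s) 0 = ly) by exact (is_derive_unique y 0 ly Hy).
      rewrite Dx, Dy. ring. }
  assert (Hpos : 0 <= 2 * (Re v * ((1 - a * x 0) ^ 2 + (a * y 0) ^ 2)
                 - (1 - a ^ 2) * (x 0 * lx + y 0 * ly))).
  { pose proof (pow2_ge_0 (Cmod v)) as Hv2.
    (* For s below this bound, |1 + s v|^2 = 1 + 2 s Re v + s^2 |v|^2 is at most 1, so the point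
       stays in the disk; the added 1 avoids a division by zero. *)
    apply (derive_nonneg_right F _ (- Re v / (Cmod v ^ 2 + 1)) HF).
    - apply Rdiv_lt_0_compat; lra.
    - unfold F. assert (y 0 ^ 2 = 1 - x 0 ^ 2) by lra.
      rewrite Rpow_mult_distr, H. ring_simplify. rewrite H. ring.
    - intros s [Hs0 Hs]. apply (Rmult_lt_compat_r (Cmod v ^ 2 + 1)) in Hs; [|lra].
      replace (- Re v / (Cmod v ^ 2 + 1) * (Cmod v ^ 2 + 1)) with (- Re v) in Hs by (field; lra).
      set (w := (z + RtoC s * (z * v))%C).
      assert (Hw2 : Cmod w ^ 2 = r ^ 2 * ((1 + s * Re v) ^ 2 + (s * Im v) ^ 2)).
      { replace w with (z * (1 + RtoC s * v))%C by (unfold w; ring).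
        rewrite Cmod_mult, Rpow_mult_distr. fold r. f_equal.
        rewrite Cmod2_alt. unfold Re, Im; simpl. ring. }
      assert (Hle : (1 + s * Re v) ^ 2 + (s * Im v) ^ 2 <= 1).
      { rewrite Cmod2_alt in Hs. nra. }
      assert (Hw : Cmod w <= r) by (apply Cmod_le_of_sqr; [lra|rewrite Hw2; nra]).
      assert (Hsp := schwarz_pick c a r w Hc Hc0 Ha Hz Hb Hw).
      assert (Hsp0 : 0 <= r * Cmod (PS c w - RtoC a)) by (apply Rmult_le_pos; [lra|apply Cmod_ge_0]).
      apply (conj Hsp0), (pow_incr _ _ 2) in Hsp.
      rewrite !Rpow_mult_distr, Hw2, !Cmod2_alt in Hsp.
      assert (EX : Re (PS c w) = x s) by reflexivity.
      assert (EY : Im (PS c w) = y s) by reflexivity.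
      replace (Re (PS c w - RtoC a)) with (x s - a) in Hsp by (rewrite <- EX; unfold Re; simpl; ring).
      replace (Im (PS c w - RtoC a)) with (y s) in Hsp by (rewrite <- EY; unfold Im; simpl; ring).
      replace (Re (1 - RtoC a * PS c w)) with (1 - a * x s) in Hsp by (rewrite <- EX; unfold Re; simpl; ring).
      replace (Im (1 - RtoC a * PS c w)) with (- (a * y s)) in Hsp by (rewrite <- EY; unfold Im; simpl; ring).
      unfold F. apply Rmult_le_reg_l with (r ^ 2); [nra|]. nra. }
  replace (Re (Cconj (PS c z) * (z * l) * v)) with (x 0 * lx + y 0 * ly)
    by (rewrite Ex, Ey; unfold lx, ly, Re, Im, Cconj; simpl; ring).
  rewrite Cmod2_alt.
  replace (Re (1 - RtoC a * PS c z)) with (1 - a * x 0) by (rewrite Ex; unfold Re; simpl; ring).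
  replace (Im (1 - RtoC a * PS c z)) with (- (a * y 0)) by (rewrite Ey; unfold Im; simpl; ring).
  replace ((- (a * y 0)) ^ 2) with ((a * y 0) ^ 2) by ring. lra.
Qed.

(** Jack's lemma with a quantitative bound; a = 0 gives the classical k >= 1. The preceding
    inequality is affine in t along v = -1 + i t and holds for every real t, which forces conj(g) z
    g' to be real; t = 0 then yields the bound. *)
Lemma boundary_log_derivative (c : nat -> C) (a : R) (z : C) :
  disk_coef c -> c O = RtoC a -> 0 <= a < 1 -> 0 < Cmod z < 1 ->
  (forall w, Cmod w <= Cmod z -> Cmod (PS c w) <= 1) -> Cmod (PS c z) = 1 ->
  exists k : R, (z * PS (dcoef c) z = RtoC k * PS c z)%C /\
    Cmod (1 - RtoC a * PS c z)%C ^ 2 <= (1 - a ^ 2) * k.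
Proof.
  intros Hc Hc0 Ha Hz Hb Hg1.
  assert (H := fun v => boundary_derivative c a z v Hc Hc0 Ha Hz Hb Hg1).
  set (W := (Cconj (PS c z) * (z * PS (dcoef c) z))%C) in *.
  set (Q := Cmod (1 - RtoC a * PS c z)%C ^ 2) in *.
  assert (Ha2 : 0 < 1 - a ^ 2) by nra.
  assert (Hlin : forall t, (1 - a ^ 2) * (- Re W - Im W * t) <= - Q).
  { intros t. assert (Hneg : Re (-1, t) < 0) by (simpl; lra).
    specialize (H (-1, t) Hneg).
    replace (Re (W * (-1, t))) with (- Re W - Im W * t) in H by (unfold Re, Im; simpl; ring).
    change (Re (-1, t)) with (-1) in H. lra. }
  assert (HIm : Im W = 0).
  { destruct (Req_dec (Im W) 0) as [E|E]; [exact E|exfalso].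
    (* This t makes the left side of [Hlin] equal to |Q| + 1, which exceeds -Q. *)
    specialize (Hlin ((- Re W - (Rabs Q + 1) / (1 - a ^ 2)) / Im W)).
    replace (Im W * ((- Re W - (Rabs Q + 1) / (1 - a ^ 2)) / Im W))
      with (- Re W - (Rabs Q + 1) / (1 - a ^ 2)) in Hlin by (field; split; [lra|exact E]).
    replace ((1 - a ^ 2) * (- Re W - (- Re W - (Rabs Q + 1) / (1 - a ^ 2))))
      with (Rabs Q + 1) in Hlin by (field; lra).
    pose proof (Rle_abs (- Q)). rewrite Rabs_Ropp in H0. lra. }
  exists (Re W). split.
  - replace (RtoC (Re W)) with W by (apply injective_projections; [reflexivity|exact HIm]).
    unfold W.
    replace (Cconj (PS c z) * (z * PS (dcoef c) z) * PS c z)%C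
      with ((PS c z * Cconj (PS c z)) * (z * PS (dcoef c) z))%C by ring.
    rewrite <- Cmod2_conj, Hg1. replace (RtoC (1 ^ 2)) with (RtoC 1) by (f_equal; ring). ring.
  - specialize (Hlin 0). rewrite HIm in Hlin. lra.
Qed.

(** * Subordination *)

Definition disk_continuous (g : C -> C) : Prop :=
  forall z, Cmod z < 1 -> forall eps, 0 < eps ->
    exists d, 0 < d /\ forall w, Cmod (w - z)%C < d -> Cmod (g w - g z)%C < eps.

Lemma disk_continuous_PS (c : nat -> C) : disk_coef c -> disk_continuous (PS c).
Proof.
  intros Hc z Hz eps Heps.
  set (l := PS (dcoef c) z). pose proof (Cmod_ge_0 l) as Hl0.
  destruct (is_derive_C_elim _ _ _ (is_derive_PS c z Hc Hz) 1 Rlt_0_1) as [d [Hd H]]. fold l in H.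
  assert (He : 0 < eps / (Cmod l + 1)) by (apply Rdiv_lt_0_compat; lra).
  exists (Rmin d (eps / (Cmod l + 1))). split; [now apply Rmin_pos|].
  intros w Hw.
  assert (Hw1 := Rlt_le_trans _ _ _ Hw (Rmin_l _ _)).
  assert (Hw2 := Rlt_le_trans _ _ _ Hw (Rmin_r _ _)).
  specialize (H (w - z)%C Hw1).
  replace (z + (w - z))%C with w in H by ring.
  pose proof (Cmod_triangle_rev (PS c w - PS c z) (l * (w - z))) as Ht.
  rewrite Cmod_mult in Ht.
  apply (Rmult_lt_compat_r (Cmod l + 1)) in Hw2; [|lra].
  replace (eps / (Cmod l + 1) * (Cmod l + 1)) with eps in Hw2 by (field; lra). lra.
Qed.

Lemma Rabs_Re_Im_lt (z : C) (d : R) :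
  Rabs (Re z) < d -> Rabs (Im z) < d -> Cmod z < 2 * d.
Proof.
  intros H1 H2. pose proof (Cmod_ge_0 z). apply Rabs_lt_between in H1, H2.
  apply Rnot_le_lt; intro Hle.
  assert (Hsq : (2 * d) ^ 2 <= Cmod z ^ 2) by (apply pow_incr; lra).
  rewrite Cmod2_alt in Hsq. nra.
Qed.

(** Compactness of the closed disk of radius t, obtained from a gauge on the square [-2, 2]^2, which
    contains every z in question because the enlargement is at most 1. *)
Lemma lt_one_extends (g : C -> C) (t : R) :
  disk_continuous g -> 0 <= t < 1 -> (forall z, Cmod z <= t -> Cmod (g z) < 1) ->
  exists d, 0 < d /\ forall z, Cmod z <= t + d -> Cmod (g z) < 1.
Proof.
  intros Hg Ht Hlt.
  (* The gauge must also be defined beyond radius t. There it is at most a third of the distance to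
     the disk, so a point z with |z| <= t + d / 2 can never be served by such a centre: its modulus
     would be less than t + 5/2 of the gauge. *)
  assert (Hloc : forall u v : R, exists d : posreal,
    (Cmod (u, v) <= t -> forall w, Cmod (w - (u, v))%C < 2 * d -> Cmod (g w) < 1) /\
    (t < Cmod (u, v) -> 3 * d <= Cmod (u, v) - t)).
  { intros u v. destruct (Rle_or_lt (Cmod (u, v)) t) as [Hle|Hgt].
    - destruct (Hg (u, v) ltac:(lra) (1 - Cmod (g (u, v)))) as [d [Hd H]].
      { specialize (Hlt (u, v) Hle). lra. }
      assert (Hd2 : 0 < d / 2) by lra.
      exists (mkposreal _ Hd2). simpl. split; [|lra].
      intros _ w Hw. specialize (H w ltac:(lra)).
      pose proof (Cmod_triangle_rev (g w) (g (u, v))). lra.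
    - assert (Hd : 0 < (Cmod (u, v) - t) / 3) by lra.
      exists (mkposreal _ Hd). simpl. split; lra. }
  set (delta := fun u v => proj1_sig (constructive_indefinite_description _ (Hloc u v))).
  assert (Hdelta : forall u v,
    (Cmod (u, v) <= t -> forall w, Cmod (w - (u, v))%C < 2 * delta u v -> Cmod (g w) < 1) /\
    (t < Cmod (u, v) -> 3 * delta u v <= Cmod (u, v) - t))
    by (intros u v; exact (proj2_sig (constructive_indefinite_description _ (Hloc u v)))).
  clearbody delta.
  destruct (compactness_value_2d (-2) 2 (-2) 2 delta) as [d Hd].
  pose proof (cond_pos d) as Hd0.
  exists (Rmin (d / 2) 1). split; [apply Rmin_pos; lra|].
  intros z Hz. assert (Hm1 := Rmin_l (d / 2) 1). assert (Hm2 := Rmin_r (d / 2) 1).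
  (* [compactness_value_2d] asserts the existence of a centre only under a double negation, so the
     goal is turned into a contradiction first. *)
  apply NNPP. intro Hn.
  assert (Hre := re_le_Cmod z).
  assert (Him : Rabs (Im z) <= Cmod z) by (eapply Rle_trans; [apply Rmax_r|apply Rmax_Cmod]).
  apply (Hd (Re z) (Im z)).
  - apply Rabs_le_between. lra.
  - apply Rabs_le_between. lra.
  - intros [u [v [_ [_ [Hu [Hv Hdd]]]]]].
    assert (Hzuv : Cmod (z - (u, v))%C < 2 * delta u v) by (now apply Rabs_Re_Im_lt).
    destruct (Hdelta u v) as [H1 H2].
    destruct (Rle_or_lt (Cmod (u, v)) t) as [Hle|Hgt].
    + apply Hn. now apply H1.
    + specialize (H2 Hgt). pose proof (Cmod_triangle_rev (u, v) z).
      rewrite Cmod_minus_sym in Hzuv. lra.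
Qed.

(** The modulus of z0 is the supremum t of the radii whose closed disk satisfies |g| < 1. If |g| < 1
    still held on the closed disk of radius t, that disk could be enlarged; the bound |g| <= 1 on
    its boundary follows by continuity from the inner points (1 - s) z. *)
Lemma first_touch (g : C -> C) (z1 : C) :
  disk_continuous g -> Cmod (g 0) < 1 -> Cmod z1 < 1 -> 1 <= Cmod (g z1) ->
  exists z0, 0 < Cmod z0 < 1 /\ Cmod (g z0) = 1 /\
    forall z, Cmod z <= Cmod z0 -> Cmod (g z) <= 1.
Proof.
  intros Hg Hg0 Hz1 Hgz1.
  set (E := fun t => 0 <= t /\ forall z, Cmod z <= t -> Cmod (g z) < 1).
  assert (HE1 : forall t, E t -> t <= Cmod z1).
  { intros t [_ Ht]. apply Rnot_lt_le; intro H. specialize (Ht z1 (Rlt_le _ _ H)). lra. }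
  assert (HE0 : E 0).
  { split; [lra|]. intros z Hz. pose proof (Cmod_ge_0 z).
    rewrite (Cmod_eq_0 z) by lra. exact Hg0. }
  destruct (completeness E) as [t [Hub Hlub]];
    [exists (Cmod z1); exact HE1|now exists 0|].
  assert (Ht0 : 0 <= t) by now apply Hub.
  assert (Ht1 : t <= Cmod z1) by now apply Hlub.
  assert (Hin : forall z, Cmod z < t -> Cmod (g z) < 1).
  { intros z Hz. apply NNPP; intro Hn.
    assert (t <= Cmod z); [|lra]. apply Hlub. intros s [Hs Hs']. apply Rnot_lt_le; intro H.
    apply Hn, Hs'. lra. }
  assert (Hex : exists z0, Cmod z0 <= t /\ 1 <= Cmod (g z0)).
  { apply NNPP; intro Hn.
    destruct (lt_one_extends g t Hg) as [d [Hd H]]; [lra| |].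
    - intros z Hz. apply Rnot_le_lt. intro H. apply Hn. now exists z.
    - assert (t + d <= t); [|lra]. apply Hub. split; [lra|exact H]. }
  destruct Hex as [z0 [Hz0 Hgz0]].
  assert (Hz0t : Cmod z0 = t).
  { destruct (Rle_lt_or_eq_dec _ _ Hz0) as [H|H]; [|exact H]. specialize (Hin _ H). lra. }
  assert (Htpos : 0 < t).
  { destruct (Rle_lt_or_eq_dec _ _ Ht0) as [H|H]; [exact H|].
    rewrite (Cmod_eq_0 z0) in Hgz0 by lra. lra. }
  assert (Hcl : forall z, Cmod z <= t -> Cmod (g z) <= 1).
  { intros z Hz. apply Rnot_lt_le; intro Hgt.
    destruct (Hg z ltac:(lra) (Cmod (g z) - 1)) as [d [Hd H]]; [lra|].
    set (s := Rmin (d / 2) (1 / 2)).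
    assert (Hs : 0 < s) by (apply Rmin_pos; lra).
    assert (Hsd : s <= d / 2) by apply Rmin_l. assert (Hs1 : s <= 1 / 2) by apply Rmin_r.
    pose proof (Cmod_ge_0 z).
    assert (Hw : Cmod (RtoC (1 - s) * z) = (1 - s) * Cmod z)
      by (rewrite Cmod_mult, Cmod_R, Rabs_pos_eq; lra).
    assert (Hwz : Cmod (RtoC (1 - s) * z - z) = s * Cmod z).
    { replace (RtoC (1 - s) * z - z)%C with (RtoC (- s) * z)%C
        by (rewrite RtoC_minus, RtoC_opp; ring).
      rewrite Cmod_mult, Cmod_R, Rabs_Ropp, Rabs_pos_eq; lra. }
    specialize (H (RtoC (1 - s) * z)%C ltac:(rewrite Hwz; nra)).
    specialize (Hin (RtoC (1 - s) * z)%C ltac:(rewrite Hw; nra)).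
    pose proof (Cmod_triangle_rev (g z) (g (RtoC (1 - s) * z)%C)).
    rewrite Cmod_minus_sym in H1. lra. }
  exists z0. rewrite Hz0t. repeat split; [lra|lra| |exact Hcl].
  apply Rle_antisym; [now apply Hcl|exact Hgz0].
Qed.

(** The unit circle passes through the pole -1 of w / (1 + w), so its image is a line, namely the
    vertical line through 1/2. *)
Lemma Re_unimodular_div (w : C) :
  Cmod w = 1 -> (1 + w)%C <> RtoC 0 -> Re (w / (1 + w))%C = / 2.
Proof.
  intros Hw Hne.
  assert (H : Re w ^ 2 + Im w ^ 2 = 1) by (rewrite <- Cmod2_alt, Hw; ring).
  assert (Hd : 0 < Cmod (1 + w) ^ 2) by (apply pow_lt; now apply Cmod_gt_0).
  rewrite Cmod2_alt in Hd. destruct w as [x y].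
  replace (Re ((x, y) / (1 + (x, y)))%C)
    with ((x * (1 + x) + y ^ 2) / ((1 + x) ^ 2 + y ^ 2));
    unfold Re, Im in *; simpl fst in *; simpl snd in *.
  - rewrite Rplus_0_l in Hd. apply Rmult_eq_reg_r with ((1 + x) ^ 2 + y ^ 2); [|lra].
    unfold Rdiv. rewrite Rmult_assoc, Rinv_l by lra. lra.
  - rewrite Rplus_0_l in *. field. lra.
Qed.

(** Near a simple zero z, w F' / F behaves like z / (w - z). Approaching radially from outside, w =
    z (1 + s) with s > 0, makes this quotient 1 / s, which is real and tends to plus infinity. *)
Lemma log_derivative_unbounded (F F' : C -> C) (z : C) (M eps : R) :
  disk_continuous F' -> Cmod z < 1 -> z <> RtoC 0 ->
  @is_derive C_AbsRing C_NormedModule F z (F' z) -> F z = RtoC 0 -> F' z <> RtoC 0 ->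
  0 < eps -> exists w, Cmod (w - z)%C < eps /\ F w <> RtoC 0 /\ M < Re (w * F' w / F w)%C.
Proof.
  intros HF' Hz Hz0 HF HFz HFz' Heps.
  assert (Hl : 0 < Cmod (F' z)) by now apply Cmod_gt_0.
  assert (Hzp : 0 < Cmod z) by now apply Cmod_gt_0.
  set (b := (z * F' z)%C).
  assert (Hb : Cmod b = Cmod z * Cmod (F' z)) by apply Cmod_mult.
  assert (Hbp : 0 < Cmod b) by (rewrite Hb; now apply Rmult_lt_0_compat).
  destruct (is_derive_C_elim _ _ _ HF (Cmod (F' z) / 4)) as [d1 [Hd1 H1]]; [lra|].
  destruct (HF' z Hz (Cmod b / 8)) as [d2 [Hd2 H2]]; [lra|].
  set (m := Rmin (Rmin d1 d2) (Rmin eps (1 - Cmod z))).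
  assert (Hm : 0 < m) by (repeat apply Rmin_pos; lra).
  (* The relative error u below satisfies |u| <= (1/2) / (3/4) = 2/3, so the real part is at least 1
     / (3 s); this choice makes it at least |M| + 1. *)
  assert (HM : 0 < / (3 * (Rabs M + 1))) by (apply Rinv_0_lt_compat; pose proof (Rabs_pos M); lra).
  set (s := Rmin (m / 2) (Rmin (1 / 8) (/ (3 * (Rabs M + 1))))).
  assert (Hs : 0 < s) by (unfold s; repeat apply Rmin_pos; lra).
  assert (Hsm : s < m) by (unfold s; eapply Rle_lt_trans; [apply Rmin_l|lra]).
  assert (Hs8 : s <= 1 / 8) by (unfold s; eapply Rle_trans; [apply Rmin_r|apply Rmin_l]).
  assert (HsM : s <= / (3 * (Rabs M + 1))) by (unfold s; eapply Rle_trans; [apply Rmin_r|apply Rmin_r]).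
  assert (Hm1 : m <= d1) by (unfold m; eapply Rle_trans; [apply Rmin_l|apply Rmin_l]).
  assert (Hm2 : m <= d2) by (unfold m; eapply Rle_trans; [apply Rmin_l|apply Rmin_r]).
  assert (Hm3 : m <= eps) by (unfold m; eapply Rle_trans; [apply Rmin_r|apply Rmin_l]).
  assert (Hm4 : m <= 1 - Cmod z) by (unfold m; eapply Rle_trans; [apply Rmin_r|apply Rmin_r]).
  set (h := (RtoC s * z)%C).
  assert (Hh : Cmod h = s * Cmod z) by (unfold h; rewrite Cmod_mult, Cmod_R, Rabs_pos_eq; lra).
  assert (Hhs : Cmod h < s) by (rewrite Hh; nra).
  set (w := (z + h)%C).
  assert (Ewz : (w - z)%C = h) by (unfold w; ring).
  assert (Hw : Cmod w <= 1) by (unfold w; eapply Rle_trans; [apply Cmod_triangle|lra]).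
  specialize (H1 h ltac:(lra)). fold w in H1. rewrite HFz in H1.
  specialize (H2 w). rewrite Ewz in H2. specialize (H2 ltac:(lra)).
  set (e1 := (F w / RtoC s - b)%C). set (e2 := (w * F' w - b)%C).
  assert (Hs0 : RtoC s <> RtoC 0) by (intros E; injection E; lra).
  assert (HFw : F w = (RtoC s * (b + e1))%C) by (unfold e1; field; exact Hs0).
  assert (HFw' : (w * F' w = b + e2)%C) by (unfold e2; ring).
  assert (He1 : Cmod e1 <= Cmod b / 4).
  { replace (F w - 0 - F' z * h)%C with (RtoC s * e1)%C in H1
      by (unfold e1, b, h; field; exact Hs0).
    rewrite Cmod_mult, Cmod_R, Rabs_pos_eq, Hh in H1 by lra.
    apply Rmult_le_reg_l with s; [exact Hs|]. rewrite Hb. lra. }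
  assert (He2 : Cmod e2 <= Cmod b / 4).
  { replace e2 with (w * (F' w - F' z) + RtoC s * b)%C by (unfold e2, b, w, h; ring).
    eapply Rle_trans; [apply Cmod_triangle|].
    rewrite !Cmod_mult, Cmod_R, Rabs_pos_eq by lra.
    pose proof (Cmod_ge_0 w). pose proof (Cmod_ge_0 (F' w - F' z)). nra. }
  assert (Hbe : 3 / 4 * Cmod b <= Cmod (b + e1)).
  { pose proof (Cmod_triangle_rev b (- e1)) as Ht. rewrite Cmod_opp in Ht.
    replace (b - - e1)%C with (b + e1)%C in Ht by ring. lra. }
  assert (Hbe0 : (b + e1)%C <> RtoC 0) by (apply Cmod_gt_0; lra).
  exists w. rewrite Ewz. split; [lra|]. split.
  - rewrite HFw. now apply Cmult_neq_0.
  - rewrite HFw, HFw'.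
    set (u := ((e2 - e1) / (b + e1))%C).
    replace ((b + e2) / (RtoC s * (b + e1)))%C with (RtoC (/ s) * (1 + u))%C
      by (unfold u; rewrite RtoC_inv by lra; field; now split).
    assert (Hu : Cmod u <= 2 / 3).
    { unfold u. rewrite Cmod_div by exact Hbe0.
      apply Rmult_le_reg_r with (Cmod (b + e1)); [lra|].
      unfold Rdiv at 1. rewrite Rmult_assoc, Rinv_l, Rmult_1_r by lra.
      eapply Rle_trans; [apply Cmod_triangle_minus|]. lra. }
    pose proof (re_le_Cmod u) as Hre.
    assert (Hre1 : - (2 / 3) <= Re u)
      by (pose proof (Rle_abs (- Re u)) as Ha; rewrite Rabs_Ropp in Ha; lra).
    replace (Re (RtoC (/ s) * (1 + u))%C) with (/ s * (1 + Re u)) by (unfold Re; simpl; ring).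
    assert (HMs : 3 * (Rabs M + 1) <= / s).
    { rewrite <- (Rinv_inv (3 * (Rabs M + 1))). apply Rinv_le_contravar; assumption. }
    pose proof (Rle_abs M). pose proof (Rabs_pos M).
    assert (/ s * (1 / 3) <= / s * (1 + Re u)) by (apply Rmult_le_compat_l; lra). lra.
Qed.

Definition ncoef (c : nat -> C) (n : nat) : C := (RtoC (INR n) * c n)%C.

(* The image of the disk under - alpha z / (1 + alpha - z) is the disk with centre -1 / (2 + alpha)
   and radius (1 + alpha) / (2 + alpha); these are the coefficients of p rescaled so that
   this image becomes the unit disk. *)
Definition ucoef (alpha : R) (q : nat -> C) (n : nat) : C :=
  (RtoC (/ (1 + alpha)) * (RtoC (2 + alpha) * q n + match n with O => 1 | S _ => 0 end))%C.

Lemma Cmod_ucoef_le (alpha : R) (q : nat -> C) (n : nat) : 0 < alpha ->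
  Cmod (ucoef alpha q n) <= / (1 + alpha) * ((2 + alpha) * Cmod (q n) + match n with O => 1 | S _ => 0 end).
Proof.
  intros Ha. unfold ucoef.
  assert (0 < / (1 + alpha)) by (apply Rinv_0_lt_compat; lra).
  rewrite Cmod_mult, Cmod_R, Rabs_pos_eq by lra.
  apply Rmult_le_compat_l; [lra|].
  eapply Rle_trans; [apply Cmod_triangle|].
  rewrite Cmod_mult, Cmod_R, (Rabs_pos_eq (2 + alpha)) by lra.
  destruct n; rewrite ?Cmod_1, ?Cmod_0; lra.
Qed.

Lemma disk_coef_ucoef (alpha : R) (q : nat -> C) :
  0 < alpha -> disk_coef q -> disk_coef (ucoef alpha q).
Proof.
  intros Ha Hq r Hr. destruct (Hq r Hr) as [M HM].
  exists (/ (1 + alpha) * ((2 + alpha) * M + 1)). intros n.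
  assert (0 < / (1 + alpha)) by (apply Rinv_0_lt_compat; lra).
  assert (Hrn : 0 <= r ^ n <= 1).
  { split; [apply pow_le; lra|]. rewrite <- (pow1 n). apply pow_incr; lra. }
  eapply Rle_trans; [apply Rmult_le_compat_r; [lra|apply Cmod_ucoef_le; exact Ha]|].
  rewrite Rmult_assoc. apply Rmult_le_compat_l; [lra|].
  specialize (HM n). destruct n; [simpl in *|]; nra.
Qed.

Lemma PS_ucoef (alpha : R) (q : nat -> C) (z : C) : 0 < alpha -> disk_coef q -> Cmod z < 1 ->
  PS (ucoef alpha q) z = (RtoC (/ (1 + alpha)) * (RtoC (2 + alpha) * PS q z + 1))%C.
Proof.
  intros Ha Hq Hz. apply CSeries_unique.
  assert (H := PS_correct q z Hq Hz).
  assert (H1 : @is_series C_AbsRing C_NormedModule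
    (fun n => match n with O => RtoC 1 | S _ => RtoC 0 end * z ^ n)%C (RtoC 1)).
  { apply is_series_C_iff. intros eps Heps. exists O. intros n _.
    replace (sum_n _ n) with (RtoC 1).
    - replace (1 - 1)%C with (RtoC 0) by ring. rewrite Cmod_0. exact Heps.
    - induction n; [rewrite sum_O; simpl|rewrite sum_Sn, <- IHn; change plus with Cplus];
      match goal with |- ?x = ?y => change (@eq C x y) end; ring. }
  assert (H2 := is_series_C_scal (RtoC (/ (1 + alpha))) _ _
    (is_series_C_plus _ _ _ _ (is_series_C_scal (RtoC (2 + alpha)) _ _ H) H1)).
  eapply is_series_C_ext; [|reflexivity|exact H2].
  intros n. unfold ucoef. cbv beta. ring.
Qed.

Lemma PS_dcoef_ucoef (alpha : R) (q : nat -> C) (z : C) : 0 < alpha -> disk_coef q -> Cmod z < 1 ->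
  PS (dcoef (ucoef alpha q)) z = (RtoC (/ (1 + alpha)) * (RtoC (2 + alpha) * PS (dcoef q) z))%C.
Proof.
  intros Ha Hq Hz. apply CSeries_unique.
  assert (H := PS_correct _ z (disk_coef_dcoef q Hq) Hz).
  assert (H2 := is_series_C_scal (RtoC (/ (1 + alpha))) _ _ (is_series_C_scal (RtoC (2 + alpha)) _ _ H)).
  eapply is_series_C_ext; [|reflexivity|exact H2].
  intros n. unfold dcoef, ucoef. cbv beta. ring.
Qed.

Lemma is_derive_C_one_plus (f : C -> C) (z l : C) :
  @is_derive C_AbsRing C_NormedModule f z l ->
  @is_derive C_AbsRing C_NormedModule (fun w => 1 + f w)%C z l.
Proof.
  intros Hf. apply is_derive_C_intro. intros eps Heps.
  destruct (is_derive_C_elim _ _ _ Hf eps Heps) as [d [Hd Hd']].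
  exists d. split; [exact Hd|]. intros h Hh. specialize (Hd' h Hh).
  now replace (1 + f (z + h) - (1 + f z) - l * h)%C with (f (z + h) - f z - l * h)%C by ring.
Qed.

(** The differential inequality is required only where 1 + p does not vanish, since the formula for
    z f'' / f' divides by 1 + p. A zero of 1 + p at the touching point is ruled out by means of
    nearby points where 1 + p is nonzero. *)
Lemma subordination (alpha : R) (q : nat -> C) :
  0 < alpha <= 1 -> disk_coef q -> q O = RtoC 0 ->
  (forall z, Cmod z < 1 -> (1 + PS q z)%C <> RtoC 0 ->
     Re (PS q z + z * PS (dcoef q) z / (1 + PS q z))%C < alpha / 2) ->
  forall z, Cmod z < 1 -> Cmod (PS (ucoef alpha q) z) <= 1.
Proof.
  intros Ha Hq Hq0 H z1 Hz1. apply Rnot_lt_le; intro Hgt.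
  set (u := ucoef alpha q) in *. set (a := / (1 + alpha)).
  assert (Hu : disk_coef u) by (apply disk_coef_ucoef; [lra|exact Hq]).
  assert (Ha1 : (1 + alpha) * a = 1) by (unfold a; field; lra).
  assert (Hap : 0 < a) by (apply Rinv_0_lt_compat; lra).
  assert (Hu0 : u O = RtoC a).
  { unfold u, ucoef. rewrite Hq0. fold a. ring. }
  assert (Hg0 : PS u 0 = RtoC a).
  { rewrite PS_shift by (exact Hu || (rewrite Cmod_0; lra)). rewrite Hu0. ring. }
  destruct (first_touch (PS u) z1) as [z [Hz [Hgz Hb]]];
    [now apply disk_continuous_PS|rewrite Hg0, Cmod_R, Rabs_pos_eq; nra|exact Hz1|lra|].
  destruct (boundary_log_derivative u a z Hu Hu0) as [k [Hk Hkb]]; [nra|exact Hz|exact Hb|exact Hgz|].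
  set (g := PS u z) in *.
  assert (Hgp : g = (RtoC a * (RtoC (2 + alpha) * PS q z + 1))%C) by (apply PS_ucoef; lra || exact Hq).
  unfold u in Hk. rewrite PS_dcoef_ucoef in Hk by (lra || exact Hq). fold a in Hk.
  set (p := PS q z) in *. set (p' := PS (dcoef q) z) in *.
  set (rho := (1 + alpha) / (2 + alpha)).
  assert (Hrho : 0 < rho) by (apply Rdiv_lt_0_compat; lra).
  (* No constant term: the centre -1 / (2 + alpha) minus the radius [rho] is -1. *)
  assert (E1 : (1 + p = RtoC rho * (1 + g))%C).
  { rewrite Hgp. apply injective_projections; simpl; unfold rho, a; field; lra. }
  assert (E2 : (z * p' = RtoC (rho * k) * g)%C).
  { rewrite RtoC_mult, <- Cmult_assoc, <- Hk.
    apply injective_projections; simpl; unfold rho, a; field; lra. }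
  assert (Hag : Cmod (RtoC a * g) < 1).
  { rewrite Cmod_mult, Hgz, Cmod_R, Rabs_pos_eq by lra. nra. }
  assert (Hkpos : 0 < k).
  { apply C1_minus_neq_0, Cmod_gt_0 in Hag.
    assert (0 < Cmod (1 - RtoC a * g) ^ 2) by now apply pow_lt.
    assert (0 < 1 - a ^ 2) by nra.
    apply Rmult_lt_reg_l with (1 - a ^ 2); lra. }
  destruct (Ceq_dec (1 + g) 0) as [Em|Em].
  - assert (Hp : (1 + p)%C = RtoC 0) by (rewrite E1, Em; ring).
    assert (HF : @is_derive C_AbsRing C_NormedModule (fun w => 1 + PS q w)%C z p').
    { apply is_derive_C_one_plus. now apply is_derive_PS. }
    (* The zero is simple because z p' = rho k g with k > 0 and |g| = 1. *)
    assert (Hp'0 : p' <> RtoC 0).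
    { intros E. rewrite E, Cmult_0_r in E2. apply (f_equal Cmod) in E2.
      rewrite Cmod_0, Cmod_mult, Hgz, Cmod_R, Rabs_pos_eq in E2 by nra. nra. }
    destruct (disk_continuous_PS q Hq z (proj2 Hz) 1 Rlt_0_1) as [d [Hd Hcont]].
    (* The extra 2 compensates the first summand: |1 + p(w)| < 1 near z gives Re p(w) >= -2. *)
    destruct (log_derivative_unbounded (fun w => 1 + PS q w)%C (PS (dcoef q)) z (alpha / 2 + 2)
                (Rmin d (1 - Cmod z))) as [w [Hw [Hw0 HwM]]].
    + apply disk_continuous_PS, disk_coef_dcoef, Hq.
    + lra.
    + apply Cmod_gt_0; lra.
    + exact HF.
    + exact Hp.
    + exact Hp'0.
    + apply Rmin_pos; lra.
    + assert (Hwd := Rlt_le_trans _ _ _ Hw (Rmin_l _ _)).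
      assert (Hw1 := Rlt_le_trans _ _ _ Hw (Rmin_r _ _)).
      pose proof (Cmod_triangle_rev w z).
      specialize (H w ltac:(lra) Hw0). specialize (Hcont w Hwd).
      replace (PS q w - PS q z)%C with (1 + PS q w - (1 + p))%C in Hcont by (unfold p; ring).
      rewrite Hp in Hcont.
      pose proof (re_le_Cmod (1 + PS q w - 0)%C) as Hre.
      apply Rabs_le_between in Hre.
      rewrite re_plus in H.
      replace (Re (1 + PS q w - 0)%C) with (1 + Re (PS q w)) in Hre by (unfold Re; simpl; ring).
      lra.
  - assert (Hr0 : RtoC rho <> RtoC 0) by (intros E; injection E; lra).
    assert (Hp : (1 + p)%C <> RtoC 0) by (rewrite E1; now apply Cmult_neq_0).
    specialize (H z (proj2 Hz) Hp). fold p p' in H.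
    rewrite re_plus in H.
    replace (z * p' / (1 + p))%C with (RtoC k * (g / (1 + g)))%C in H
      by (rewrite E2, E1, RtoC_mult; field; now split).
    replace (Re (RtoC k * (g / (1 + g)))) with (k * Re (g / (1 + g))) in H by (unfold Re; simpl; ring).
    rewrite (Re_unimodular_div g Hgz Em) in H.
    assert (Ep : Re p = rho * (1 + Re g) - 1).
    { replace p with ((1 + p) - 1)%C by ring. rewrite E1. unfold Re; simpl; ring. }
    rewrite Ep in H.
    assert (Hx : Re g <= 1).
    { pose proof (re_le_Cmod g) as Hre. rewrite Hgz in Hre. apply Rabs_le_between in Hre. lra. }
    assert (Hsq : Cmod (1 - RtoC a * g) ^ 2 = 1 - 2 * a * Re g + a ^ 2).
    { assert (Hg1 : Re g ^ 2 + Im g ^ 2 = 1) by (rewrite <- Cmod2_alt, Hgz; ring).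
      rewrite Cmod2_alt.
      replace (Re (1 - RtoC a * g)) with (1 - a * Re g) by (unfold Re; simpl; ring).
      replace (Im (1 - RtoC a * g)) with (- a * Im g) by (unfold Im; simpl; ring).
      replace (a ^ 2) with (a ^ 2 * (Re g ^ 2 + Im g ^ 2)) by (rewrite Hg1; ring). ring. }
    rewrite Hsq in Hkb. set (x := Re g) in *.
    assert (Hk2 : (1 + alpha) ^ 2 + 1 - 2 * (1 + alpha) * x <= alpha * (2 + alpha) * k).
    { apply (Rmult_le_compat_l ((1 + alpha) ^ 2)) in Hkb; [|apply pow2_ge_0].
      replace ((1 + alpha) ^ 2 * (1 - 2 * a * x + a ^ 2))
        with ((1 + alpha) ^ 2 + 1 - 2 * (1 + alpha) * x) in Hkb by (unfold a; field; lra).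
      replace ((1 + alpha) ^ 2 * ((1 - a ^ 2) * k)) with (alpha * (2 + alpha) * k) in Hkb
        by (unfold a; field; lra). exact Hkb. }
    assert (Hfin : 2 * alpha * (2 + alpha) * (rho * (1 + x) - 1 + k * / 2) < 2 * alpha * (2 + alpha) * (alpha / 2))
      by (apply Rmult_lt_compat_l; [nra|lra]).
    replace (2 * alpha * (2 + alpha) * (rho * (1 + x) - 1 + k * / 2))
      with (2 * alpha * (1 + alpha) * (1 + x) - 2 * alpha * (2 + alpha) + alpha * (2 + alpha) * k) in Hfin
      by (unfold rho; field; lra).
    (* After multiplication by 2 alpha (2 + alpha), the lower bound for the left side exceeds the
       right side by 2 (1 - alpha^2) (1 - x) + alpha^2 (1 - alpha). Both terms are nonnegative
       precisely because alpha <= 1 and x <= 1. *)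
    assert (0 <= (1 - alpha ^ 2) * (1 - x)) by (apply Rmult_le_pos; nra).
    assert (0 <= alpha ^ 2 * (1 - alpha)) by (apply Rmult_le_pos; nra).
    lra.
Qed.

(** * Coefficients of bounded functions *)

Lemma Rsum_shift (F : nat -> R) (n : nat) : Rsum F (S n) = F O + Rsum (fun k => F (S k)) n.
Proof.
  induction n; [simpl; ring|].
  change (Rsum F (S (S n))) with (Rsum F (S n) + F (S n)). rewrite IHn. simpl. ring.
Qed.

Lemma pnorm2_nonneg (r : R) (l : list C) : 0 <= pnorm2 r l.
Proof.
  induction l as [|a l IH]; simpl pnorm2; [lra|].
  pose proof (pow2_ge_0 (Cmod a)). pose proof (pow2_ge_0 r). nra.
Qed.

Lemma Rsum_nonneg (F : nat -> R) (n : nat) : (forall k, 0 <= F k) -> 0 <= Rsum F n.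
Proof. intros H. induction n; simpl; [lra|specialize (H n); lra]. Qed.

(** Only the coefficients of index at most n are kept, and their weights r^(2 k) are all at least
    r^(2 n). *)
Lemma pnorm2_ge (r : R) (n : nat) (l : list C) : 0 <= r <= 1 ->
  (r ^ 2) ^ n * Rsum (fun k => Cmod (nth k l 0) ^ 2) (S n) <= pnorm2 r l.
Proof.
  intros Hr. revert l; induction n; intros l.
  - destruct l as [|a l]; simpl pnorm2; cbn [Rsum]; simpl nth.
    + rewrite Cmod_0. lra.
    + pose proof (pnorm2_nonneg r l). pose proof (pow2_ge_0 r). nra.
  - rewrite Rsum_shift. destruct l as [|a l].
    + rewrite (Rsum_ext _ (fun _ => 0)) by (intros; simpl; rewrite Cmod_0; ring).
      rewrite Rsum_const. simpl nth. simpl pnorm2. rewrite Cmod_0. lra.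
    + simpl nth. simpl pnorm2. specialize (IHn l).
      rewrite Rmult_plus_distr_l.
      assert (Hr2 : 0 <= r ^ 2 <= 1) by nra.
      apply Rplus_le_compat.
      * apply Rle_trans with (1 * Cmod a ^ 2); [|lra].
        apply Rmult_le_compat_r; [apply pow2_ge_0|].
        rewrite <- (pow1 (S n)). now apply pow_incr.
      * change ((r ^ 2) ^ S n) with (r ^ 2 * (r ^ 2) ^ n). rewrite Rmult_assoc.
        apply Rmult_le_compat_l; [lra|exact IHn].
Qed.

Lemma nth_padd (l m : list C) (k : nat) : nth k (padd l m) 0 = (nth k l 0 + nth k m 0)%C.
Proof.
  revert m k; induction l as [|a l IH]; intros m k.
  - simpl padd. destruct k; simpl; ring.
  - destruct m as [|b m]; destruct k as [|k]; simpl; try ring. apply IH.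
Qed.

Lemma nth_plist (c : nat -> C) (n k : nat) : (k <= n)%nat -> nth k (plist c n) 0 = c k.
Proof.
  revert c k; induction n; intros c [|k] Hk; simpl; try reflexivity; [lia|].
  rewrite IHn by lia. reflexivity.
Qed.

Lemma peval_repeat0 (n : nat) (l : list C) (z : C) :
  peval (repeat (RtoC 0) n ++ l) z = (z ^ n * peval l z)%C.
Proof. induction n; simpl; [ring|rewrite IHn; ring]. Qed.

Lemma pnorm2_repeat0 (r : R) (n : nat) (l : list C) :
  pnorm2 r (repeat (RtoC 0) n ++ l) = (r ^ 2) ^ n * pnorm2 r l.
Proof.
  induction n; [simpl; ring|].
  simpl repeat. simpl app. simpl pnorm2. rewrite IHn, Cmod_0. simpl. ring.
Qed.

(* Multiplication by a function bounded by 1 is a contraction of H^2; it is tested on 1 + t z^n. *)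
Lemma unit_bounded_coef (u : nat -> C) (n : nat) (t : C) :
  disk_coef u -> (forall z, Cmod z < 1 -> Cmod (PS u z) <= 1) -> (0 < n)%nat ->
  Rsum (fun k => Cmod (u k) ^ 2) n + Cmod (u n + t * u O)%C ^ 2 <= 1 + Cmod t ^ 2.
Proof.
  intros Hu Hb Hn.
  set (X := Rsum (fun k => Cmod (u k) ^ 2) n + Cmod (u n + t * u O)%C ^ 2).
  set (Y := 1 + Cmod t ^ 2).
  assert (HY : 0 < Y) by (unfold Y; pose proof (pow2_ge_0 (Cmod t)); lra).
  assert (HX : 0 <= X).
  { unfold X. apply Rplus_le_le_0_compat; [apply Rsum_nonneg; intros; apply pow2_ge_0|apply pow2_ge_0]. }
  (* The contraction property at radius 1 - d, for a truncation of the series that is bounded there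
     by 1 + d; the claim is the limit d -> 0. *)
  assert (Hmain : forall d, 0 < d < 1 -> ((1 - d) ^ 2) ^ n * X <= (1 + d) ^ 2 * Y).
  { intros d Hd. set (r := 1 - d).
    destruct (PS_plist_unif u r d Hu) as [N HN]; [unfold r; lra|lra|].
    (* At least n + 1 coefficients are kept, so those of index at most n are exact, whatever N the
       approximation needs. *)
    set (l := plist u (N + n)).
    assert (Hl : forall z, Cmod z = r -> Cmod (peval l z) <= 1 + d).
    { intros z Hz. specialize (HN (N + n)%nat (Nat.le_add_r _ _) z (Req_le _ _ Hz)). fold l in HN.
      specialize (Hb z ltac:(unfold r in Hz; lra)).
      pose proof (Cmod_triangle_rev (peval l z) (PS u z)) as Ht. rewrite Cmod_minus_sym in Ht. lra. }
    (* The coefficients of (1 + t z^n) l(z): below index n they are those of u, and at index n the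
       value is u_n + t u_0. *)
    set (lv := padd l (repeat (RtoC 0) n ++ map (Cmult t) l)).
    set (v := RtoC 1 :: repeat (RtoC 0) (pred n) ++ [t]).
    assert (Hv : forall z, peval v z = (1 + t * z ^ n)%C).
    { intros z. unfold v. simpl. rewrite peval_repeat0. simpl.
      destruct n as [|m]; [lia|]. simpl. ring. }
    assert (Hlv : forall z, peval lv z = (peval v z * peval l z)%C).
    { intros z. unfold lv. rewrite peval_padd, peval_repeat0, peval_map, Hv. ring. }
    assert (Hnorm : pnorm2 r lv <= (1 + d) ^ 2 * pnorm2 r v).
    (* Enough nodes for Parseval to be exact on both polynomials, which are then compared node by
       node. *)
    { set (M := S (length lv + length v)).
      assert (HM : 0 < INR M) by (apply lt_0_INR; unfold M; lia).
      assert (Hr : 0 <= r) by (unfold r; lra).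
      apply Rmult_le_reg_l with (INR M); [exact HM|].
      rewrite <- (parseval r M lv Hr) by (unfold M; lia).
      replace (INR M * ((1 + d) ^ 2 * pnorm2 r v)) with ((1 + d) ^ 2 * (INR M * pnorm2 r v)) by ring.
      rewrite <- (parseval r M v Hr) by (unfold M; lia).
      rewrite <- Rsum_scal. apply Rsum_le. intros j.
      rewrite Hlv, Cmod_mult, Rpow_mult_distr, Rmult_comm.
      apply Rmult_le_compat_r; [apply pow2_ge_0|].
      apply pow_incr. split; [apply Cmod_ge_0|]. apply Hl. now apply Cmod_node. }
    assert (Hrr : 0 <= r <= 1) by (unfold r; lra).
    assert (Hge := pnorm2_ge r n lv Hrr).
    assert (HXe : Rsum (fun k => Cmod (nth k lv 0) ^ 2) (S n) = X).
    { assert (E : forall j, (j <= n)%nat -> Rsum (fun k => Cmod (nth k lv 0) ^ 2) j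
                   = Rsum (fun k => Cmod (u k) ^ 2) j).
      { induction j; intros Hj; [reflexivity|]. cbn [Rsum]. rewrite IHj by lia. do 3 f_equal.
        unfold lv. rewrite nth_padd. unfold l at 1. rewrite nth_plist by lia.
        rewrite app_nth1 by (rewrite repeat_length; lia). rewrite nth_repeat. ring. }
      cbn [Rsum]. rewrite E by lia. unfold X. do 3 f_equal.
      unfold lv. rewrite nth_padd. unfold l at 1. rewrite nth_plist by lia.
      rewrite app_nth2, repeat_length, Nat.sub_diag by (rewrite repeat_length; lia).
      f_equal. unfold l. destruct (N + n)%nat; simpl; ring. }
    rewrite HXe in Hge.
    assert (Hvn : pnorm2 r v <= Y).
    { unfold v. simpl pnorm2. rewrite pnorm2_repeat0, Cmod_1. simpl pnorm2. unfold Y.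
      assert (0 <= (r ^ 2) ^ pred n <= 1).
      { split; [apply pow_le, pow2_ge_0|]. rewrite <- (pow1 (pred n)). apply pow_incr. nra. }
      assert (0 <= r ^ 2 <= 1) by nra.
      pose proof (pow2_ge_0 (Cmod t)).
      assert (r ^ 2 * ((r ^ 2) ^ pred n * (Cmod t ^ 2 + r ^ 2 * 0)) <= 1 * (1 * Cmod t ^ 2)).
      { rewrite Rmult_0_r, Rplus_0_r.
        apply Rmult_le_compat; [lra|apply Rmult_le_pos; lra|lra|]. apply Rmult_le_compat_r; lra. }
      lra. }
    fold r. eapply Rle_trans; [exact Hge|]. eapply Rle_trans; [exact Hnorm|].
    apply Rmult_le_compat_l; [apply pow2_ge_0|exact Hvn]. }
  apply le_epsilon. intros eps Heps.
  (* From (1 - 2 n d) X <= (1 + 3 d) Y one gets X <= Y + d K, and d K <= eps by the choice of d. *)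
  set (K := 2 * INR n * X + 3 * Y).
  assert (HK : 0 < K) by (unfold K; pose proof (pos_INR n); nra).
  set (d := Rmin (1 / 2) (eps / K)).
  assert (Hd : 0 < d) by (apply Rmin_pos; [lra|now apply Rdiv_lt_0_compat]).
  assert (Hd1 : d <= 1 / 2) by apply Rmin_l.
  assert (Hd2 : d * K <= eps).
  { apply Rle_trans with (eps / K * K); [apply Rmult_le_compat_r; [lra|apply Rmin_r]|].
    right; field; lra. }
  specialize (Hmain d ltac:(lra)).
  assert (Hbern : 1 - 2 * INR n * d <= ((1 - d) ^ 2) ^ n).
  { clearbody d. clear -Hd Hd1. induction n; [simpl; lra|].
    rewrite S_INR. pose proof (pos_INR n).
    assert (0 <= ((1 - d) ^ 2) ^ n <= 1).
    { split; [apply pow_le, pow2_ge_0|]. rewrite <- (pow1 n) at 2. apply pow_incr. nra. }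
    change (((1 - d) ^ 2) ^ S n) with ((1 - d) ^ 2 * ((1 - d) ^ 2) ^ n).
    set (y := ((1 - d) ^ 2) ^ n) in *. clearbody y. pose proof (pow2_ge_0 d).
    assert (0 <= (1 - d) ^ 2 * (y - (1 - 2 * INR n * d)))
      by (apply Rmult_le_pos; [apply pow2_ge_0|lra]).
    assert (0 <= INR n * d * d) by (repeat apply Rmult_le_pos; lra).
    assert (0 <= INR n * d * d * (1 - d)) by (apply Rmult_le_pos; lra). lra. }
  assert ((1 - 2 * INR n * d) * X <= (1 + 3 * d) * Y).
  { apply Rle_trans with (((1 - d) ^ 2) ^ n * X); [apply Rmult_le_compat_r; assumption|].
    eapply Rle_trans; [exact Hmain|]. apply Rmult_le_compat_r; [lra|nra]. }
  unfold K in Hd2. lra.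
Qed.

(** The rescaled function has the real constant coefficient a = 1 / (1 + alpha). Testing with the
    best t improves the weight of the last coefficient from 1 to 1 / (1 - a^2), and this gain makes
    the third bound of the theorem sharp. *)
Lemma ncoef_sum_step (alpha : R) (q : nat -> C) (n : nat) :
  0 < alpha -> disk_coef q -> q O = RtoC 0 ->
  (forall z, Cmod z < 1 -> Cmod (PS (ucoef alpha q) z) <= 1) ->
  alpha * (2 + alpha) * Rsum (fun k => Cmod (q (S k)) ^ 2) n
    + (1 + alpha) ^ 2 * Cmod (q (S n)) ^ 2 <= alpha ^ 2.
Proof.
  intros Ha Hq Hq0 Hb. set (u := ucoef alpha q) in *. set (a := / (1 + alpha)).
  assert (Hap : 0 < a) by (apply Rinv_0_lt_compat; lra).
  set (rho := (1 + alpha) / (2 + alpha)).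
  assert (Hu0 : u O = RtoC a) by (unfold u, ucoef; rewrite Hq0; fold a; ring).
  assert (HuS : forall k, Cmod (u (S k)) ^ 2 = (/ rho) ^ 2 * Cmod (q (S k)) ^ 2).
  { intros k. rewrite <- Rpow_mult_distr. f_equal. unfold u, ucoef. fold a.
    replace (RtoC a * (RtoC (2 + alpha) * q (S k) + 0))%C with (RtoC (/ rho) * q (S k))%C.
    - rewrite Cmod_mult, Cmod_R, Rabs_pos_eq; [reflexivity|].
      left. apply Rinv_0_lt_compat, Rdiv_lt_0_compat; lra.
    - apply injective_projections; simpl; unfold rho, a; field; lra. }
  (* t = s u_n maximizes |u_n + a t|^2 - |t|^2, with maximum |u_n|^2 / (1 - a^2). *)
  set (s := a / (1 - a ^ 2)).
  assert (Ha2 : 0 < 1 - a ^ 2).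
  { assert (a * (1 + alpha) = 1) by (unfold a; field; lra). nra. }
  assert (H := unit_bounded_coef u (S n) (RtoC s * u (S n))%C
                 (disk_coef_ucoef alpha q Ha Hq) Hb (Nat.lt_0_succ n)).
  rewrite Hu0 in H.
  replace (u (S n) + RtoC s * u (S n) * RtoC a)%C with (RtoC (1 + s * a) * u (S n))%C in H
    by (rewrite RtoC_plus, RtoC_mult; ring).
  rewrite !Cmod_mult, !Rpow_mult_distr, !Cmod_R, !pow2_abs, Rsum_shift, Hu0, Cmod_R, pow2_abs in H.
  rewrite (Rsum_ext _ _ _ HuS), Rsum_scal, HuS in H.
  set (A := Rsum (fun k => Cmod (q (S k)) ^ 2) n) in *.
  set (U := Cmod (q (S n)) ^ 2) in *.
  assert (H2 : (/ rho) ^ 2 * A + (/ rho) ^ 2 * U / (1 - a ^ 2) <= 1 - a ^ 2).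
  { replace ((1 + s * a) ^ 2) with (/ (1 - a ^ 2) + s ^ 2) in H by (unfold s; field; lra).
    unfold Rdiv. lra. }
  apply (Rmult_le_compat_l (rho ^ 2 * (1 + alpha) ^ 2 * (1 - a ^ 2))) in H2.
  2:{ apply Rmult_le_pos; [apply Rmult_le_pos; apply pow2_ge_0|lra]. }
  replace (alpha * (2 + alpha) * A + (1 + alpha) ^ 2 * U) with
    (rho ^ 2 * (1 + alpha) ^ 2 * (1 - a ^ 2) * ((/ rho) ^ 2 * A + (/ rho) ^ 2 * U / (1 - a ^ 2))).
  2:{ unfold rho, a. field. repeat split; nra. }
  replace (alpha ^ 2) with (rho ^ 2 * (1 + alpha) ^ 2 * (1 - a ^ 2) * (1 - a ^ 2)); [exact H2|].
  unfold rho, a. field. lra.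
Qed.

(** * The complex exponential and the logarithm of f(z)/z *)

Lemma Cexp_plus (z w : C) : Cexp (z + w) = (Cexp z * Cexp w)%C.
Proof.
  unfold Cexp. rewrite re_plus, im_plus, exp_plus, cos_plus, sin_plus.
  apply injective_projections; simpl; ring.
Qed.

Lemma Cexp_neq_0 (z : C) : Cexp z <> RtoC 0.
Proof.
  unfold Cexp. intros E. injection E as H1 H2.
  pose proof (exp_pos (Re z)) as He. pose proof (sin2_cos2 (Im z)) as Hsc. unfold Rsqr in Hsc.
  assert (cos (Im z) = 0) by nra. assert (sin (Im z) = 0) by nra. nra.
Qed.

Lemma Cmod_le_abs_sum (x y : R) : Cmod (x, y) <= Rabs x + Rabs y.
Proof.
  pose proof (Rabs_pos x). pose proof (Rabs_pos y).
  apply Cmod_le_of_sqr; [lra|]. rewrite Cmod2_alt. unfold Re, Im; simpl fst; simpl snd.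
  rewrite <- (pow2_abs x), <- (pow2_abs y). nra.
Qed.

Lemma derivable_at_0_bound (F : R -> R) (l eps : R) :
  derivable_pt_lim F 0 l -> 0 < eps ->
  exists d, 0 < d /\ forall h, Rabs h < d -> Rabs (F h - F 0 - l * h) <= eps * Rabs h.
Proof.
  intros H Heps. destruct (H eps Heps) as [d Hd].
  exists d. split; [apply cond_pos|]. intros h Hh.
  destruct (Req_dec h 0) as [->|Hh0].
  - replace (F 0 - F 0 - l * 0) with 0 by ring. rewrite Rabs_R0. lra.
  - specialize (Hd h Hh0 Hh). rewrite Rplus_0_l in Hd.
    replace (F h - F 0 - l * h) with (((F h - F 0) / h - l) * h) by (field; exact Hh0).
    rewrite Rabs_mult. apply Rmult_le_compat_r; [apply Rabs_pos|lra].
Qed.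

(** The derivative at 0 comes from those of the real exp, cos and sin; the functional equation
    carries it to z. *)
Lemma is_derive_Cexp (z : C) : @is_derive C_AbsRing C_NormedModule Cexp z (Cexp z).
Proof.
  assert (H0 : forall eps, 0 < eps -> exists d, 0 < d /\ forall h, Cmod h < d ->
     Cmod (Cexp h - 1 - h)%C <= eps * Cmod h).
  { intros eps Heps.
    (* The two components contribute e |x| + 2 e |y| and 3 e |y|, together at most 6 e |h|. *)
    set (e := Rmin (eps / 6) 1). assert (He : 0 < e) by (apply Rmin_pos; lra).
    assert (He1 : e <= 1) by apply Rmin_r.
    assert (He2 : 6 * e <= eps) by (pose proof (Rmin_l (eps / 6) 1); unfold e; lra).
    pose proof (derivable_pt_lim_exp 0) as Dexp. rewrite exp_0 in Dexp.
    pose proof (derivable_pt_lim_cos 0) as Dcos. rewrite sin_0 in Dcos.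
    pose proof (derivable_pt_lim_sin 0) as Dsin. rewrite cos_0 in Dsin.
    destruct (derivable_at_0_bound _ _ e Dexp He) as [d1 [Hd1 H1]].
    destruct (derivable_at_0_bound _ _ e Dcos He) as [d2 [Hd2 H2]].
    destruct (derivable_at_0_bound _ _ e Dsin He) as [d3 [Hd3 H3]].
    exists (Rmin (Rmin d1 d2) (Rmin d3 (e / 2))). split; [repeat apply Rmin_pos; lra|].
    intros [x y] Hh.
    assert (Hx : Rabs x <= Cmod (x, y)) by apply (re_le_Cmod (x, y)).
    assert (Hy : Rabs y <= Cmod (x, y)) by (eapply Rle_trans; [apply Rmax_r|apply (Rmax_Cmod (x, y))]).
    assert (B1 := Rlt_le_trans _ _ _ Hh (Rle_trans _ _ _ (Rmin_l _ _) (Rmin_l _ _))).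
    assert (B2 := Rlt_le_trans _ _ _ Hh (Rle_trans _ _ _ (Rmin_l _ _) (Rmin_r _ _))).
    assert (B3 := Rlt_le_trans _ _ _ Hh (Rle_trans _ _ _ (Rmin_r _ _) (Rmin_l _ _))).
    assert (B4 := Rlt_le_trans _ _ _ Hh (Rle_trans _ _ _ (Rmin_r _ _) (Rmin_r _ _))).
    specialize (H1 x ltac:(lra)). specialize (H2 y ltac:(lra)). specialize (H3 y ltac:(lra)).
    rewrite exp_0, Rmult_1_l in H1. rewrite cos_0 in H2. rewrite sin_0, Rmult_1_l in H3.
    replace (cos y - 1 - - 0 * y) with (cos y - 1) in H2 by ring.
    rewrite Rminus_0_r in H3.
    pose proof (Rabs_pos x). pose proof (Rabs_pos y).
    assert (Hex : Rabs (exp x - 1) <= e).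
    { replace (exp x - 1) with ((exp x - 1 - x) + x) by ring.
      eapply Rle_trans; [apply Rabs_triang|]. nra. }
    assert (Hex2 : Rabs (exp x) <= 2).
    { replace (exp x) with ((exp x - 1) + 1) by ring.
      eapply Rle_trans; [apply Rabs_triang|]. rewrite Rabs_R1. lra. }
    assert (Hcy : Rabs (cos y) <= 1) by (apply Rabs_le; pose proof (COS_bound y); lra).
    assert (Hx1 : Rabs (1 + x) <= 2).
    { eapply Rle_trans; [apply Rabs_triang|]. rewrite Rabs_R1. lra. }
    replace (Cexp (x, y) - 1 - (x, y))%C with
      ((exp x - 1 - x) * cos y + (1 + x) * (cos y - 1), exp x * (sin y - y) + y * (exp x - 1))
      by (unfold Cexp; apply injective_projections; simpl; ring).
    eapply Rle_trans; [apply Cmod_le_abs_sum|].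
    assert (T1 : Rabs ((exp x - 1 - x) * cos y + (1 + x) * (cos y - 1)) <= e * Rabs x * 1 + 2 * (e * Rabs y)).
    { eapply Rle_trans; [apply Rabs_triang|]. rewrite !Rabs_mult.
      apply Rplus_le_compat; apply Rmult_le_compat; auto using Rabs_pos. }
    assert (T2 : Rabs (exp x * (sin y - y) + y * (exp x - 1)) <= 2 * (e * Rabs y) + Rabs y * e).
    { eapply Rle_trans; [apply Rabs_triang|]. rewrite !Rabs_mult.
      apply Rplus_le_compat; apply Rmult_le_compat; auto using Rabs_pos, Rle_refl. }
    assert (e * Rabs x <= e * Cmod (x, y)) by (apply Rmult_le_compat_l; lra).
    assert (e * Rabs y <= e * Cmod (x, y)) by (apply Rmult_le_compat_l; lra).
    assert (6 * e * Cmod (x, y) <= eps * Cmod (x, y)) by (apply Rmult_le_compat_r; [apply Cmod_ge_0|lra]).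
    lra. }
  apply is_derive_C_intro. intros eps Heps.
  pose proof (Cmod_ge_0 (Cexp z)).
  destruct (H0 (eps / (Cmod (Cexp z) + 1))) as [d [Hd Hd']]; [apply Rdiv_lt_0_compat; lra|].
  exists d. split; [exact Hd|]. intros h Hh. specialize (Hd' h Hh).
  rewrite Cexp_plus.
  replace (Cexp z * Cexp h - Cexp z - Cexp z * h)%C with (Cexp z * (Cexp h - 1 - h))%C by ring.
  rewrite Cmod_mult.
  apply Rle_trans with ((Cmod (Cexp z) + 1) * (eps / (Cmod (Cexp z) + 1) * Cmod h)).
  - apply Rmult_le_compat; [lra|apply Cmod_ge_0|lra|exact Hd'].
  - right. field. lra.
Qed.

(* The two normed-module structures on C have the same norm but different uniform structures. *)
Lemma is_derive_C_AbsRing (f : C -> C) (z l : C) :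
  @is_derive C_AbsRing C_NormedModule f z l <->
  @is_derive C_AbsRing (AbsRing_NormedModule C_AbsRing) f z l.
Proof. split; intros [_ H]; (split; [apply is_linear_scal_l|exact H]). Qed.

Lemma is_derive_C_mult (f g : C -> C) (z df dg : C) :
  @is_derive C_AbsRing C_NormedModule f z df -> @is_derive C_AbsRing C_NormedModule g z dg ->
  @is_derive C_AbsRing C_NormedModule (fun w => f w * g w)%C z (df * g z + f z * dg)%C.
Proof.
  rewrite !is_derive_C_AbsRing. intros Hf Hg.
  exact (is_derive_mult f g z df dg Hf Hg Cmult_comm).
Qed.

Lemma is_derive_C_comp (f g : C -> C) (z df dg : C) :
  @is_derive C_AbsRing C_NormedModule f (g z) df -> @is_derive C_AbsRing C_NormedModule g z dg ->
  @is_derive C_AbsRing C_NormedModule (fun w => f (g w)) z (dg * df)%C.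
Proof.
  intros Hf Hg. apply is_derive_C_AbsRing in Hg. exact (is_derive_comp f g z df dg Hf Hg).
Qed.

Lemma is_derive_C_ext_disk (f g : C -> C) (z l : C) :
  (forall w, Cmod w < 1 -> f w = g w) -> Cmod z < 1 ->
  @is_derive C_AbsRing C_NormedModule f z l -> @is_derive C_AbsRing C_NormedModule g z l.
Proof.
  intros Hfg Hz Hf. apply is_derive_C_intro. intros eps Heps.
  destruct (is_derive_C_elim f z l Hf eps Heps) as [d [Hd H]].
  exists (Rmin d (1 - Cmod z)). split; [apply Rmin_pos; lra|].
  intros h Hh.
  assert (Hh1 := Rlt_le_trans _ _ _ Hh (Rmin_l _ _)).
  assert (Hh2 := Rlt_le_trans _ _ _ Hh (Rmin_r _ _)).
  rewrite <- !Hfg; [now apply H|exact Hz|].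
  eapply Rle_lt_trans; [apply Cmod_triangle|lra].
Qed.

Lemma PS_ncoef (c : nat -> C) (z : C) : disk_coef c -> Cmod z < 1 ->
  PS (ncoef c) z = (z * PS (dcoef c) z)%C.
Proof.
  intros Hc Hz. rewrite (PS_shift (ncoef c)) by (exact (disk_coef_mult_n c Hc) || exact Hz).
  unfold ncoef at 1. simpl INR. change (fun n => ncoef c (S n)) with (dcoef c). ring.
Qed.

(** With E = exp L and q standing for z L', the product rule gives f' = E (1 + q) and f'' = L' E (1
    + q) + E q'. Dividing by f' uses that E never vanishes and that 1 + q is nonzero at z. *)
Lemma convexity_operator (c : nat -> C) (f : C -> C) (z : C) :
  disk_coef c -> (forall w, Cmod w < 1 -> f w = (w * Cexp (PS c w))%C) -> Cmod z < 1 ->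
  (1 + PS (ncoef c) z)%C <> RtoC 0 ->
  (z * C_derive (C_derive f) z / C_derive f z =
   PS (ncoef c) z + z * PS (dcoef (ncoef c)) z / (1 + PS (ncoef c) z))%C.
Proof.
  intros Hc Hf Hz Hp.
  set (q := ncoef c) in *. assert (Hq : disk_coef q) by exact (disk_coef_mult_n c Hc).
  set (E := fun w => Cexp (PS c w)).
  assert (DE : forall w, Cmod w < 1 ->
    @is_derive C_AbsRing C_NormedModule E w (PS (dcoef c) w * E w)%C).
  { intros w Hw. apply (is_derive_C_comp Cexp (PS c)); [apply is_derive_Cexp|now apply is_derive_PS]. }
  assert (D1 : forall w, Cmod w < 1 -> C_derive f w = (E w * (1 + PS q w))%C).
  { intros w Hw. apply is_C_derive_unique.
    apply is_derive_C_ext_disk with (fun w => w * E w)%C; [|exact Hw|].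
    - intros v Hv. symmetry. now apply Hf.
    - replace (E w * (1 + PS q w))%C with (1 * E w + w * (PS (dcoef c) w * E w))%C
        by (unfold q; rewrite PS_ncoef by assumption; ring).
      apply (is_derive_C_mult (fun w => w) E); [|now apply DE].
      apply is_derive_C_AbsRing. exact (is_derive_id (K := C_AbsRing) w). }
  assert (D2 : C_derive (C_derive f) z
     = (PS (dcoef c) z * E z * (1 + PS q z) + E z * PS (dcoef q) z)%C).
  { apply is_C_derive_unique.
    apply is_derive_C_ext_disk with (fun w => E w * (1 + PS q w))%C; [|exact Hz|].
    - intros v Hv. symmetry. now apply D1.
    - apply (is_derive_C_mult E (fun w => 1 + PS q w)%C); [now apply DE|].
      apply is_derive_C_one_plus. now apply is_derive_PS. }
  rewrite D2, D1 by exact Hz. unfold q at 4. rewrite PS_ncoef by assumption. fold q.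
  assert (HE : E z <> RtoC 0) by apply Cexp_neq_0.
  field. now split.
Qed.

Lemma is_series_C_terms_bounded (a : nat -> C) (l : C) :
  @is_series C_AbsRing C_NormedModule a l -> exists M, forall n, Cmod (a n) <= M.
Proof.
  intros H. destruct (proj1 (is_series_C_iff a l) H 1 Rlt_0_1) as [N HN].
  assert (Hfin : forall m, exists M, forall n, (n <= m)%nat -> Cmod (a n) <= M).
  { induction m as [|m [M HM]].
    - exists (Cmod (a O)). intros n Hn. replace n with O by lia. lra.
    - exists (Rmax M (Cmod (a (S m)))). intros n Hn.
      destruct (Nat.eq_dec n (S m)) as [->|Hne]; [apply Rmax_r|].
      eapply Rle_trans; [apply HM; lia|apply Rmax_l]. }
  destruct (Hfin N) as [M HM]. exists (Rmax M 2). intros n.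
  destruct (Nat.le_gt_cases n N) as [Hn|Hn]; [eapply Rle_trans; [now apply HM|apply Rmax_l]|].
  eapply Rle_trans; [|apply Rmax_r]. destruct n as [|n]; [lia|].
  assert (H1 := HN n ltac:(lia)). assert (H2 := HN (S n) ltac:(lia)).
  rewrite sum_Sn in H2. change plus with Cplus in H2.
  set (s := sum_n a n : C) in *. change (Cmod (s + a (S n) - l)%C < 1) in H2.
  change (Cmod (s - l)%C < 1) in H1.
  replace (a (S n)) with ((s + a (S n) - l) - (s - l))%C by ring.
  eapply Rle_trans; [apply Cmod_triangle_minus|]. lra.
Qed.

Lemma disk_coef_of_convergence (c : nat -> C) :
  (forall r, 0 <= r < 1 -> exists l, @is_series C_AbsRing C_NormedModule (fun n => c n * RtoC r ^ n)%C l) ->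
  disk_coef c.
Proof.
  intros H r Hr. destruct (H r Hr) as [l Hl].
  destruct (is_series_C_terms_bounded _ _ Hl) as [M HM]. exists M. intros n. specialize (HM n).
  now rewrite Cmod_mult, Cmod_pow, Cmod_R, Rabs_pos_eq in HM by lra.
Qed.

(** * Nonnegative real sums and the final estimates *)

(** Summation by parts: the induction carries the stronger bound that the weighted sum is at least
    its last weight times the unweighted sum. *)
Lemma abel_summation_nonneg (w d : nat -> R) (n : nat) :
  (forall k, w (S k) <= w k) -> (forall k, 0 <= w k) -> (forall m, 0 <= Rsum d m) ->
  0 <= Rsum (fun k => w k * d k) n.
Proof.
  intros Hw Hw0 Hd.
  assert (H : forall m, w m * Rsum d (S m) <= Rsum (fun k => w k * d k) (S m)).
  { induction m; [simpl; lra|].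
    change (Rsum d (S (S m))) with (Rsum d (S m) + d (S m)).
    change (Rsum (fun k => w k * d k) (S (S m)))
      with (Rsum (fun k => w k * d k) (S m) + w (S m) * d (S m)).
    specialize (Hw m). specialize (Hd (S m)).
    assert (w (S m) * Rsum d (S m) <= w m * Rsum d (S m)) by (apply Rmult_le_compat_r; assumption).
    lra. }
  destruct n as [|n]; [simpl; lra|]. eapply Rle_trans; [|apply H].
  apply Rmult_le_pos; auto.
Qed.

Lemma sum_n_Rsum (F : nat -> R) (n : nat) : sum_n F n = Rsum F (S n).
Proof.
  induction n; [rewrite sum_O; simpl; symmetry; apply Rplus_0_l|].
  rewrite sum_Sn, IHn. reflexivity.
Qed.

Lemma nonneg_series_bounded (F : nat -> R) (B : R) :
  (forall k, 0 <= F k) -> (forall n, Rsum F n <= B) -> ex_series F /\ Series F <= B.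
Proof.
  intros HF HB.
  assert (Hf : ex_finite_lim_seq (sum_n F)).
  { apply ex_finite_lim_seq_incr with B.
    - intros n. rewrite sum_Sn. change plus with Rplus. specialize (HF (S n)). lra.
    - intros n. rewrite sum_n_Rsum. apply HB. }
  destruct Hf as [l Hl].
  assert (Hs : is_series F l) by exact Hl.
  split; [now exists l|]. rewrite (is_series_unique _ _ Hs).
  change (Rbar_le (Finite l) (Finite B)).
  apply is_lim_seq_le with (sum_n F) (fun _ => B); [|exact Hl|apply is_lim_seq_const].
  intros n. rewrite sum_n_Rsum. apply HB.
Qed.

Lemma Rsum_le_Series (F : nat -> R) (n : nat) :
  (forall k, 0 <= F k) -> ex_series F -> Rsum F n <= Series F.
Proof.
  intros HF [l Hl]. rewrite (is_series_unique _ _ Hl).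
  assert (H : sum_n F n <= l).
  { apply (is_lim_seq_incr_compare (sum_n F)); [exact Hl|].
    intros k. rewrite sum_Sn. change plus with Rplus. specialize (HF (S k)). lra. }
  rewrite sum_n_Rsum in H. simpl in H. specialize (HF n). lra.
Qed.

Theorem theorem2 (alpha : R) (halpha : 0 < alpha <= 1)
  (f : C -> C) (hf : class_G alpha f)
  (gamma : nat -> C) (hgamma : logarithmic_coefficients f gamma) :
  (ex_series (fun n : nat => INR (S n) ^ 2 * Cmod (gamma (S n)) ^ 2) /\
   Series (fun n : nat => INR (S n) ^ 2 * Cmod (gamma (S n)) ^ 2)
     <= alpha / (4 * (alpha + 2))) /\
  (ex_series (fun n : nat => Cmod (gamma (S n)) ^ 2) /\
   Series (fun n : nat => Cmod (gamma (S n)) ^ 2)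
     <= alpha ^ 2 / 4 * Li2 (1 / (1 + alpha) ^ 2)) /\
  (forall n : nat, (1 <= n)%nat ->
     Cmod (gamma n) <= alpha / (2 * (alpha + 1) * INR n)).
Proof.
  destruct hf as [_ [_ [Hf0 [_ HG]]]].
  destruct hgamma as [L [[_ [_ HLf]] HL]].
  (* The coefficients of L itself, hence the factor 2; index 0 is set to 0 because L(0) = 0 and
     [gamma 0] is arbitrary. *)
  set (c := fun n => match n with O => RtoC 0 | S _ => (2 * gamma n)%C end).
  assert (Hser : forall z, Cmod z < 1 ->
    @is_series C_AbsRing C_NormedModule (fun n => c n * z ^ n)%C (L z)).
  { intros z Hz. assert (H := is_series_C_scal 2 _ _ (HL z Hz)).
    eapply is_series_C_ext; [reflexivity| |apply is_series_C_cons; eapply is_series_C_ext; [|reflexivity|exact H]].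
    - cbv beta. simpl c. field.
    - intros n. cbv beta. simpl c. ring. }
  assert (Hc : disk_coef c).
  { apply disk_coef_of_convergence. intros r Hr. exists (L r). apply Hser.
    rewrite Cmod_R, Rabs_pos_eq; lra. }
  assert (HPS : forall z, Cmod z < 1 -> PS c z = L z)
    by (intros z Hz; now apply CSeries_unique, Hser).
  assert (Hfz : forall z, Cmod z < 1 -> f z = (z * Cexp (PS c z))%C).
  { intros z Hz. rewrite HPS by exact Hz.
    destruct (Ceq_dec z 0) as [->|Hz0]; [rewrite Hf0; ring|].
    rewrite HLf by assumption. field. exact Hz0. }
  set (q := ncoef c).
  assert (Hq : disk_coef q) by exact (disk_coef_mult_n c Hc).
  assert (Hq0 : q O = RtoC 0) by (unfold q, ncoef; simpl; ring).
  assert (Hunit : forall z, Cmod z < 1 -> Cmod (PS (ucoef alpha q) z) <= 1).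
  { apply subordination; [exact halpha|exact Hq|exact Hq0|].
    intros z Hz Hp. specialize (HG z Hz).
    rewrite (convexity_operator c f z Hc Hfz Hz Hp) in HG.
    rewrite (re_plus 1) in HG. change (Re 1) with 1 in HG. fold q in HG. lra. }
  assert (Hstep := fun n => ncoef_sum_step alpha q n (proj1 halpha) Hq Hq0 Hunit).
  set (F := fun k => Cmod (q (S k)) ^ 2) in *.
  assert (HqS : forall k, Cmod (q (S k)) = 2 * (INR (S k) * Cmod (gamma (S k)))).
  { intros k. unfold q, ncoef, c. rewrite !Cmod_mult, Cmod_INR, Cmod_R, Rabs_pos_eq by lra. ring. }
  assert (HF0 : forall k, 0 <= F k) by (intros; apply pow2_ge_0).
  assert (HSpos : forall k, 0 < INR (S k)) by (intros; apply lt_0_INR; lia).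
  set (x := 1 / (1 + alpha) ^ 2).
  assert (Hx : 0 < x < 1).
  { unfold x. split; [apply Rdiv_lt_0_compat; nra|]. apply Rmult_lt_reg_r with ((1 + alpha) ^ 2); [nra|].
    unfold Rdiv. rewrite Rmult_assoc, Rinv_l; nra. }
  (* Since alpha (2 + alpha) = (1 + alpha)^2 - 1, the coefficient inequality is a recursion for the
     partial sums. *)
  assert (Hrec : forall n, Rsum F (S n) <= x * (Rsum F n + alpha ^ 2)).
  { intros n. specialize (Hstep n). change (Rsum F (S n)) with (Rsum F n + F n).
    change (F n) with (Cmod (q (S n)) ^ 2).
    apply Rmult_le_reg_l with ((1 + alpha) ^ 2); [nra|].
    replace ((1 + alpha) ^ 2 * (x * (Rsum F n + alpha ^ 2))) with (Rsum F n + alpha ^ 2)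
      by (unfold x; field; lra).
    lra. }
  (* alpha / (alpha + 2) is the fixed point of the increasing map S -> x (S + alpha^2), and the sums
     start at 0 below it. *)
  assert (HA : forall n, Rsum F n <= alpha / (alpha + 2)).
  { assert (Hfix : x * (alpha / (alpha + 2) + alpha ^ 2) = alpha / (alpha + 2))
      by (unfold x; field; split; lra).
    induction n; [simpl; apply Rdiv_le_0_compat; lra|].
    eapply Rle_trans; [apply Hrec|]. rewrite <- Hfix. apply Rmult_le_compat_l; lra. }
  (* The same recursion unrolled; the right side is the partial sum of the squared coefficients of
     the extremal function. *)
  assert (HT : forall n, Rsum F n <= alpha ^ 2 * Rsum (fun k => x ^ S k) n).
  { induction n; [simpl; lra|].
    eapply Rle_trans; [apply Hrec|]. rewrite Rsum_shift.
    rewrite (Rsum_ext (fun k => x ^ S (S k)) (fun k => x * x ^ S k)) by reflexivity.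
    rewrite Rsum_scal.
    apply Rle_trans with (x * (alpha ^ 2 * Rsum (fun k => x ^ S k) n + alpha ^ 2));
      [apply Rmult_le_compat_l; lra|]. right. simpl. ring. }
  split; [|split].
  - apply nonneg_series_bounded; [intros; apply Rmult_le_pos; apply pow2_ge_0|].
    intros n. rewrite (Rsum_ext _ (fun k => / 4 * F k)).
    + rewrite Rsum_scal. specialize (HA n).
      replace (alpha / (4 * (alpha + 2))) with (/ 4 * (alpha / (alpha + 2))) by (field; lra). lra.
    + intros k. unfold F. rewrite HqS. field.
  - apply nonneg_series_bounded; [intros; apply pow2_ge_0|]. intros n.
    set (w := fun k => / (4 * INR (S k) ^ 2)).
    assert (Hw0 : forall k, 0 < w k).
    { intros k. apply Rinv_0_lt_compat. specialize (HSpos k). nra. }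
    rewrite (Rsum_ext _ (fun k => w k * F k)).
    2:{ intros k. unfold F, w. rewrite HqS. specialize (HSpos k). field. lra. }
    (* The differences need not be nonnegative one by one, but their partial sums are, by [HT], and
       the weights 1 / (4 n^2) decrease. *)
    assert (Hab : 0 <= Rsum (fun k => w k * (alpha ^ 2 * x ^ S k + -1 * F k)) n).
    { apply abel_summation_nonneg.
      - intros k. unfold w. apply Rinv_le_contravar; [specialize (HSpos k); nra|].
        rewrite (S_INR (S k)). specialize (HSpos k). nra.
      - intros k. left. apply Hw0.
      - intros m. rewrite Rsum_plus, !Rsum_scal. specialize (HT m). lra. }
    rewrite (Rsum_ext _ (fun k => alpha ^ 2 / 4 * (x ^ S k / INR (S k) ^ 2) + -1 * (w k * F k))) in Hab.
    2:{ intros k. unfold w. specialize (HSpos k). field. lra. }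
    rewrite Rsum_plus, !Rsum_scal in Hab.
    assert (Hli : Rsum (fun k => x ^ S k / INR (S k) ^ 2) n <= Li2 x).
    { assert (Ht0 : forall k, 0 <= x ^ S k / INR (S k) ^ 2).
      { intros k. apply Rdiv_le_0_compat; [apply pow_le; lra|]. apply pow_lt, HSpos. }
      apply Rsum_le_Series; [exact Ht0|].
      apply (@ex_series_le R_AbsRing R_CompleteNormedModule) with (fun k => x ^ k).
      - intros k. change norm with Rabs. rewrite Rabs_pos_eq by apply Ht0.
        assert (1 <= INR (S k)) by (rewrite S_INR; pose proof (pos_INR k); lra).
        assert (0 <= x ^ k) by (apply pow_le; lra).
        apply Rmult_le_reg_r with (INR (S k) ^ 2); [nra|].
        unfold Rdiv. rewrite Rmult_assoc, Rinv_l, Rmult_1_r by nra.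
        simpl (x ^ S k). assert (1 <= INR (S k) ^ 2) by nra. nra.
      - exists (/ (1 - x)). apply is_series_geom. rewrite Rabs_pos_eq; lra. }
    assert (alpha ^ 2 / 4 * Rsum (fun k => x ^ S k / INR (S k) ^ 2) n <= alpha ^ 2 / 4 * Li2 x)
      by (apply Rmult_le_compat_l; nra).
    lra.
  - intros [|n] Hn; [lia|].
    specialize (Hstep n). fold (F n) in Hstep.
    assert (Hs0 : 0 <= Rsum F n) by now apply Rsum_nonneg.
    assert (HFn : ((1 + alpha) * Cmod (q (S n))) ^ 2 <= alpha ^ 2).
    { rewrite Rpow_mult_distr. change (Cmod (q (S n)) ^ 2) with (F n).
      assert (0 <= alpha * (2 + alpha) * Rsum F n) by (apply Rmult_le_pos; nra). lra. }
    rewrite HqS in HFn. specialize (HSpos n). pose proof (Cmod_ge_0 (gamma (S n))) as Hg0.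
    assert (Hle : (1 + alpha) * (2 * (INR (S n) * Cmod (gamma (S n)))) <= alpha).
    { apply Rnot_lt_le; intro Hgt. nra. }
    apply Rmult_le_reg_r with (2 * (alpha + 1) * INR (S n)); [nra|].
    replace (alpha / (2 * (alpha + 1) * INR (S n)) * (2 * (alpha + 1) * INR (S n))) with alpha
      by (field; lra).
    lra.
Qed.
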